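(* Let $(R,\mathfrak m)$ be a $d$-dimensional Cohen-Macaulay local ring of characteristic $p>0$, let $I\subset R$ be an $\mathfrak m$-primary ideal, and let $J$ be a reduction of $I$ that is a parameter ideal. Then for any real number $r\geq \mu(I/J^{*})$ and any real numbers $1\leq t\leq s$, \[e_s(I)\;\geq\;\left(\frac{\mathcal H_t(d)-r\,\mathcal H_{t-1}(d)}{\mathcal H_s(d)}\right)e(I).\]
   Context: Local rings are commutative and Noetherian. Let $(R,\mathfrak m)$ be a local ring of prime characteristic $p>0$ and dimension $d\ge 1$; $\lambda$ denotes length and $I^{[p^e]}$ is the ideal generated by the $p^e$-th powers of the elements of $I$. For $\mathfrak m$-primary ideals $I,J$ and real $s>0$ put $h_s(I,J)=\lim_{e\to\infty}\lambda\big(R/(I^{\lceil sp^e\rceil}+J^{[p^e]})\big)/p^{ed}$ (this limit exists), $\mathcal H_s(d)=\sum_{i=0}^{\lfloor s\rfloor}\frac{(-1)^i}{d!}\binom{d}{i}(s-i)^d$ (with $\mathcal H_s(d)=0$ for $s\le 0$), $e_s(I,J)=h_s(I,J)/\mathcal H_s(d)$ and $e_s(I)=e_s(I,I)$. $e(I)=\lim_{n\to\infty} d!\,\lambda(R/I^n)/n^d$ is the Hilbert-Samuel multiplicity. A parameter ideal is an ideal generated by a (full) system of parameters. $J^{*}$ is the tight closure of $J$, $\mu$ is the minimal number of generators of a module, and $I/J^{*}$ means the image of $I$ in $R/J^{*}$, i.e. $(I+J^{*})/J^{*}$. *)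

(* Defs.v *)
From mathcomp Require Export all_boot all_order all_algebra.
From mathcomp Require Export all_classical all_reals all_analysis.
Export Order.TTheory GRing.Theory Num.Theory.
Export numFieldNormedType.Exports.

Set Implicit Arguments.
Unset Strict Implicit.
Unset Printing Implicit Defensive.

Local Open Scope classical_set_scope.
Local Open Scope ring_scope.

Section Ideals.
Variable R : comNzRingType.
Implicit Types (A B I J P Q m : set R).

(* Unlike MathComp's [idealr_closed], the unit ideal is allowed. *)
Definition ideal A : Prop :=
  [/\ A 0, (forall x y, A x -> A y -> A (x + y))
    & (forall a x, A x -> A (a * x))].

Definition ideal_gen (S : set R) : set R := smallest ideal S.

Definition ideal_add A B : set R := [set a + b | a in A & b in B].

Definition ideal_mul A B : set R := ideal_gen [set a * b | a in A & b in B].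

Definition ideal_exp A (n : nat) : set R := iter n (ideal_mul A) setT.

Definition frobenius_power (p : nat) A (e : nat) : set R :=
  ideal_gen [set x ^+ (p ^ e)%N | x in A].

Definition prime_ideal P : Prop :=
  [/\ ideal P, ~ P 1 & forall x y, P (x * y) -> P x \/ P y].

Definition minimal_prime P : Prop :=
  prime_ideal P /\ forall Q, prime_ideal Q -> Q `<=` P -> Q = P.

Definition maximal_ideal m : Prop :=
  [/\ ideal m, ~ m 1 & forall A, ideal A -> ~ A 1 -> m `<=` A -> A = m].

Definition primary_ideal A : Prop :=
  [/\ ideal A, ~ A 1
    & forall x y, A (x * y) -> A x \/ exists n : nat, A (y ^+ n)].

Definition radical A : set R := [set x | exists n : nat, A (x ^+ n)].

Definition m_primary m A : Prop := primary_ideal A /\ radical A = m.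

Definition local_ring m : Prop :=
  maximal_ideal m /\ forall m', maximal_ideal m' -> m' = m.

(* Chains C 0 < C 1 < ... < C n, with n strict inclusions, of members of F. *)
Definition strict_chain (F : set R -> Prop) (n : nat) : Prop :=
  exists C : nat -> set R,
    (forall i, (i <= n)%N -> F (C i)) /\
    (forall i, (i < n)%N -> C i `<` C i.+1).

Definition krull_dim_is (d : nat) : Prop :=
  strict_chain prime_ideal d /\
  forall n, strict_chain prime_ideal n -> (n <= d)%N.

Definition regular_sequence m (n : nat) (x : 'I_n -> R) : Prop :=
  (forall i, m (x i)) /\
  (forall (i : 'I_n) (y : R),
     let A := ideal_gen [set x j | j in [set j : 'I_n | (j < i)%N]] in
     A (x i * y) -> A y).

Definition depth_is m (n : nat) : Prop :=
  (exists x : 'I_n -> R, regular_sequence m x) /\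
  forall k (x : 'I_k -> R), regular_sequence m x -> (k <= n)%N.

Definition cohen_macaulay m : Prop :=
  exists n : nat, krull_dim_is n /\ depth_is m n.

Definition parameter_ideal m (d : nat) J : Prop :=
  m_primary m J /\ exists x : 'I_d -> R, J = ideal_gen (range x).

Definition reduction J I : Prop :=
  [/\ ideal J, J `<=` I
    & exists n : nat, ideal_exp I n.+1 = ideal_mul J (ideal_exp I n)].

Definition tight_closure (p : nat) J : set R :=
  [set x | exists c : R,
     (forall P, minimal_prime P -> ~ P c) /\
     exists e0 : nat, forall e, (e0 <= e)%N ->
       frobenius_power p J e (c * x ^+ (p ^ e)%N)].

(* The image of I in R/B is generated by the images of n elements of I. *)
Definition image_generated_by I B (n : nat) : Prop :=
  exists x : 'I_n -> R, range x `<=` I /\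
    ideal_add I B = ideal_add (ideal_gen (range x)) B.

(* Minimal number of generators of (I + B)/B; the default 0 is only reached
   when this module is not finitely generated. *)
Definition mu_quot I B : nat :=
  xget 0%N [set n | image_generated_by I B n /\
                    forall k, image_generated_by I B k -> (n <= k)%N].

End Ideals.

Definition noetherian (R : comNzRingType) : Prop :=
  forall A : set R, ideal A ->
    exists (n : nat) (x : 'I_n -> R), A = ideal_gen (range x).

Section Multiplicities.
Variables (K : realType) (R : comNzRingType).
Implicit Types (A I J : set R).

(* Submodules of R/A are the ideals of R containing A. *)
Definition length_quot A : \bar K :=
  ereal_sup [set n%:R%:E | n in
    [set n : nat | strict_chain (fun B => ideal B /\ A `<=` B) n]].

Definition h_seq (p d : nat) (s : K) I J (e : nat) : K :=
  fine (length_quot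
    (ideal_add (ideal_exp I `|Num.ceil (s * (p ^ e)%:R)|%N)
               (frobenius_power p J e)))
  / (p ^ (e * d))%:R.

Definition h_mult (p d : nat) (s : K) I J : K :=
  limn (h_seq p d s I J).

Definition Hcal (d : nat) (s : K) : K :=
  if 0 < s then
    \sum_(0 <= i < (Num.truncn s).+1)
      (-1) ^+ i / d`!%:R * 'C(d, i)%:R * (s - i%:R) ^+ d
  else 0.

Definition s_mult2 (p d : nat) (s : K) I J : K :=
  h_mult p d s I J / Hcal d s.

Definition s_mult (p d : nat) (s : K) I : K := s_mult2 p d s I I.

Definition hs_mult (d : nat) I : K :=
  limn (fun n : nat =>
    d`!%:R * fine (length_quot (ideal_exp I n)) / n%:R ^+ d).

End Multiplicities.

(* Main.v *)
Require Import Defs.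
From mathcomp Require Import ring lra.

(** Write [q = p^e] and [n] for the ceiling of [t q]. As [t <= s], the length of
    [R/(I^n + I^[q])] is a lower bound for the length that defines [h_s(I, I)],
    and it remains to compare [I^n + I^[q]] with [E = I^n + J^[q]]. Choose
    generators [f] of [I] modulo the tight closure of [J], [mu] in number. Then
    [I^[q]] is generated over [E] by the [f^q] and by [q]-th powers [g^q] of
    finitely many elements of the tight closure. Since [E : f^q] contains
    [I^(n-q) + J^[q]], each [f^q] adds at most the length of the quotient by
    this ideal. Since [E : g^q] contains [J^[q]] and an element [c] outside the
    minimal primes, and [R/(c)] has dimension at most [d - 1], each [g^q] adds
    only a term of order [q^(d-1)]. This is [colen_frobenius_le].

    Both [I^n + J^[q]] and [I^(n-q) + J^[q]] are sandwiched between ideals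
    [J^k + J^[q]], up to a bounded shift of [k], because a power of [I] lies in
    the power of [J] of an exponent that is smaller by a constant. In a
    Cohen-Macaulay ring [J] is generated by a regular sequence
    ([regular_parameters]), so that [R/(J^k + J^[q])] is filtered by the
    monomials of degree less than [k] with exponents less than [q], each with
    the factor [R/J] ([filtered_trunc_power]). The number of these monomials is
    given by inclusion and exclusion, and divided by [q^d] it tends to
    [Hcal d tau] when [k/q] tends to [tau] ([cvg_trunc_count]). The same
    filtration without truncation shows that [e(I)] is the length of [R/J]
    ([hs_multE]).

    In the limit, [H_t e(I) <= h_s(I, I) + mu H_(t-1) e(I)]. As [H_(t-1)] and
    [e(I)] are nonnegative, [mu] may be replaced by [r], and dividing by
    [H_s >= 0] gives the inequality.

    All lengths are computed from the exact sequence
    [0 -> R/(A : v) -> R/A -> R/(A + (v)) -> 0] ([colen_split]), so only ideals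
    of [R] occur and no modules. *)

Set Implicit Arguments.
Unset Strict Implicit.
Unset Printing Implicit Defensive.

Local Open Scope classical_set_scope.
Local Open Scope ring_scope.

(** * Ideals *)

Section IdealCalculus.
Variable R : comNzRingType.
Implicit Types (A B C : set R) (v x y : R) (s : seq R).

Lemma ideal_0 A : ideal A -> A 0. Proof. by case. Qed.
Lemma ideal_D A x y : ideal A -> A x -> A y -> A (x + y).
Proof. by case=> _ h _; apply: h. Qed.
Lemma ideal_M A a x : ideal A -> A x -> A (a * x).
Proof. by case=> _ _; apply. Qed.
Lemma ideal_Mr A a x : ideal A -> A x -> A (x * a).
Proof. by move=> iA Ax; rewrite mulrC; apply: ideal_M. Qed.
Lemma ideal_N A x : ideal A -> A x -> A (- x).
Proof. by move=> iA Ax; rewrite -mulN1r; apply: ideal_M. Qed.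
Lemma ideal_B A x y : ideal A -> A x -> A y -> A (x - y).
Proof. by move=> iA Ax Ay; apply: ideal_D => //; apply: ideal_N. Qed.
Lemma ideal_DKl A x y : ideal A -> A x -> A (x + y) -> A y.
Proof. by move=> iA Ax Axy; rewrite -[y](addKr x) addrC; apply: ideal_B. Qed.
Lemma ideal_BKr A x y : ideal A -> A y -> A (x - y) -> A x.
Proof. by move=> iA Ay Axy; rewrite -[x](subrK y); apply: ideal_D. Qed.

Lemma ideal_setT : ideal [set: R]. Proof. by []. Qed.

Lemma ideal_zero : ideal [set 0 : R].
Proof.
by split=> //= [x y -> ->|a x ->]; rewrite ?addr0 ?mulr0.
Qed.

Lemma ideal_eqT A : ideal A -> A 1 -> A = setT.
Proof.
by move=> iA A1; apply/seteqP; split=> // x _; rewrite -[x]mulr1; apply: ideal_M.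
Qed.

Lemma ideal_gen_ideal (S : set R) : ideal (ideal_gen S).
Proof.
split=> [A [[]] //|x y hx hy A [iA SA]|a x hx A [iA SA]].
- by apply: ideal_D; [|apply: hx|apply: hy].
- by apply: ideal_M; [|apply: hx].
Qed.

Lemma sub_ideal_gen (S : set R) : S `<=` ideal_gen S.
Proof. exact: sub_gen_smallest. Qed.

Lemma ideal_gen_sub (S : set R) A : ideal A -> S `<=` A -> ideal_gen S `<=` A.
Proof. exact: smallest_sub. Qed.

Lemma ideal_add_ideal A B : ideal A -> ideal B -> ideal (ideal_add A B).
Proof.
move=> iA iB; split.
- by exists 0; [exact: ideal_0|exists 0; [exact: ideal_0|rewrite addr0]].
- move=> _ _ [a Aa [b Bb <-]] [a' Aa' [b' Bb' <-]].
  exists (a + a'); first exact: ideal_D.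
  by exists (b + b'); [exact: ideal_D|rewrite addrACA].
- move=> c _ [a Aa [b Bb <-]].
  by exists (c * a); [exact: ideal_M|exists (c * b); [exact: ideal_M|rewrite mulrDr]].
Qed.

Lemma ideal_add_subl A B : ideal B -> A `<=` ideal_add A B.
Proof. by move=> iB a Aa; exists a => //; exists 0; [exact: ideal_0|rewrite addr0]. Qed.

Lemma ideal_add_subr A B : ideal A -> B `<=` ideal_add A B.
Proof. by move=> iA b Bb; exists 0; [exact: ideal_0|exists b => //; rewrite add0r]. Qed.

Lemma ideal_add_sub A B C :
  ideal C -> A `<=` C -> B `<=` C -> ideal_add A B `<=` C.
Proof. by move=> iC AC BC _ [a /AC Ca [b /BC Cb <-]]; apply: ideal_D. Qed.

Lemma ideal_mul_ideal A B : ideal (ideal_mul A B).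
Proof. exact: ideal_gen_ideal. Qed.

Lemma ideal_mulM A B a b : A a -> B b -> ideal_mul A B (a * b).
Proof. by move=> Aa Bb; apply: sub_ideal_gen; exists a => //; exists b. Qed.

Lemma ideal_mul_sub A B C : ideal C ->
  (forall a b, A a -> B b -> C (a * b)) -> ideal_mul A B `<=` C.
Proof.
by move=> iC h; apply: ideal_gen_sub => // _ [a Aa [b Bb <-]]; apply: h.
Qed.

Lemma ideal_exp_ideal A n : ideal (ideal_exp A n).
Proof. by case: n => [|n]; [exact: ideal_setT|exact: ideal_mul_ideal]. Qed.

(** The ideal [A : v]; it is also the annihilator of the class of [v] in [R/A]. *)
Definition colon A v : set R := [set r | A (r * v)].

Lemma colon_ideal A v : ideal A -> ideal (colon A v).
Proof.
move=> iA; rewrite /colon; split=> /= [|x y Ax Ay|a x Ax].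
- by rewrite mul0r; exact: ideal_0.
- by rewrite mulrDl; exact: ideal_D.
- by rewrite -mulrA; exact: ideal_M.
Qed.

Lemma sub_colon A v : ideal A -> A `<=` colon A v.
Proof. by move=> iA a Aa; apply: ideal_Mr. Qed.

Lemma colonS A B v : A `<=` B -> colon A v `<=` colon B v.
Proof. by move=> AB r /AB. Qed.

Lemma ideal_expM A i j x y :
  ideal_exp A i x -> ideal_exp A j y -> ideal_exp A (i + j) (x * y).
Proof.
elim: i x y => [|i IH] x y Ax Ay.
  by apply: ideal_M => //; exact: ideal_exp_ideal.
move: x Ax; apply: ideal_mul_sub; first exact: (@colon_ideal _ y (ideal_exp_ideal _ _)).
move=> a b Aa Ab; rewrite /colon /= -mulrA; apply: ideal_mulM => //.
exact: IH.
Qed.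

Lemma ideal_exp_exp A n x : A x -> ideal_exp A n (x ^+ n).
Proof.
move=> Ax; elim: n => [|n IH]; first by [].
by rewrite exprS; apply: ideal_mulM.
Qed.

Lemma ideal_expS A B n : A `<=` B -> ideal_exp A n `<=` ideal_exp B n.
Proof.
move=> AB; elim: n => [|n IH]; first by [].
apply: ideal_mul_sub => [|a b /AB Ba /IH Bb]; first exact: ideal_mul_ideal.
exact: ideal_mulM.
Qed.

Lemma ideal_exp_leq A n k : (n <= k)%N -> ideal_exp A k `<=` ideal_exp A n.
Proof.
move=> /subnKC <-; elim: (k - n)%N => [|j IH]; first by rewrite addn0.
rewrite addnS; apply: ideal_mul_sub => [|a b _ /IH]; first exact: ideal_exp_ideal.
by apply: ideal_M; exact: ideal_exp_ideal.
Qed.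

(** The ideal [A + (v)]; cyclic extensions are taken one at a time, since every
    length below is computed through [R/A -> R/(A + (v))] and its kernel
    [R/(A : v)]. *)
Definition adjoin A v : set R := [set y | exists a r, A a /\ y = a + r * v].

Lemma adjoin_ideal A v : ideal A -> ideal (adjoin A v).
Proof.
move=> iA; split.
- by exists 0, 0; split; [exact: ideal_0|rewrite mul0r addr0].
- move=> _ _ [a [r [Aa ->]]] [b [t [Ab ->]]].
  by exists (a + b), (r + t); split; [exact: ideal_D|ring].
- move=> c _ [a [r [Aa ->]]].
  by exists (c * a), (c * r); split; [exact: ideal_M|ring].
Qed.

Lemma sub_adjoin A v : A `<=` adjoin A v.
Proof. by move=> a Aa; exists a, 0; rewrite mul0r addr0. Qed.

Lemma mem_adjoin A v : ideal A -> adjoin A v v.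
Proof. by move=> iA; exists 0, 1; split; [exact: ideal_0|ring]. Qed.

Lemma adjoin_sub A B v : ideal B -> A `<=` B -> B v -> adjoin A v `<=` B.
Proof.
by move=> iB AB Bv _ [a [r [/AB Ba ->]]]; apply: ideal_D => //; apply: ideal_M.
Qed.

Lemma adjoinS A B v : A `<=` B -> adjoin A v `<=` adjoin B v.
Proof. by move=> AB _ [a [r [/AB Ba ->]]]; exists a, r. Qed.

Lemma adjoinAC A v w : ideal A -> adjoin (adjoin A v) w = adjoin (adjoin A w) v.
Proof.
move=> iA; apply/seteqP; split=> _ [_ [r [[a [t [Aa ->]]] ->]]].
- by exists (a + r * w), t; split; [exists a, r|ring].
- by exists (a + r * v), t; split; [exists a, r|ring].
Qed.

Definition adjoins A s : set R := foldl adjoin A s.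

Lemma adjoins_ideal A s : ideal A -> ideal (adjoins A s).
Proof. by elim: s A => //= v s IH A iA; apply/IH/adjoin_ideal. Qed.

Lemma sub_adjoins A s : A `<=` adjoins A s.
Proof.
by elim: s A => [|v s IH] A a Aa //=; apply: IH; exact: sub_adjoin.
Qed.

Lemma mem_adjoins A s v : ideal A -> v \in s -> adjoins A s v.
Proof.
elim: s A => //= w s IH A iA; rewrite inE => /orP[/eqP ->|vs].
  by apply: sub_adjoins; exact: mem_adjoin.
by apply: IH => //; exact: adjoin_ideal.
Qed.

Lemma adjoins_sub A B s : ideal B -> A `<=` B -> (forall v, v \in s -> B v) ->
  adjoins A s `<=` B.
Proof.
move=> iB; elim: s A => //= v s IH A AB sB; apply: IH => [|w ws].
  by apply: adjoin_sub => //; apply: sB; rewrite mem_head.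
by apply: sB; rewrite inE ws orbT.
Qed.

Lemma adjoins_adjoin A s v : ideal A ->
  adjoins (adjoin A v) s = adjoin (adjoins A s) v.
Proof.
by elim: s A => //= w s IH A iA; rewrite adjoinAC // IH //; exact: adjoin_ideal.
Qed.

Lemma adjoins_rcons A s v : adjoins A (rcons s v) = adjoin (adjoins A s) v.
Proof. by rewrite /adjoins foldl_rcons. Qed.

Lemma ideal_gen_seq s : ideal_gen [set v | v \in s] = adjoins [set 0] s.
Proof.
apply/seteqP; split.
  apply: ideal_gen_sub; first by apply: adjoins_ideal; exact: ideal_zero.
  by move=> v vs; apply: mem_adjoins; [exact: ideal_zero|exact: vs].
apply: adjoins_sub; first exact: ideal_gen_ideal.
- by move=> _ ->; apply: ideal_0; exact: ideal_gen_ideal.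
- by move=> v vs; exact: (@sub_ideal_gen [set w | w \in s]).
Qed.

Lemma ideal_gen_range n (x : 'I_n -> R) :
  ideal_gen (range x) = adjoins [set 0] [seq x i | i <- enum 'I_n].
Proof.
rewrite -ideal_gen_seq; congr ideal_gen; apply/seteqP; split=> v /=.
  by case=> i _ <-; apply: map_f; rewrite mem_enum.
by case/mapP=> i _ ->; exists i.
Qed.

End IdealCalculus.

(** * Colength *)

Section Colength.
Variable R : comNzRingType.
Implicit Types (A B C X Y : set R) (v : R).

(** Strict chains are recorded by their last member, which makes them easy to
    extend and to concatenate. *)
Inductive chain_to (F : set R -> Prop) : nat -> set R -> Prop :=
| chain_to0 X : F X -> chain_to F 0 X
| chain_toS n X Y : chain_to F n X -> F Y -> X `<` Y -> chain_to F n.+1 Y.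

Lemma chain_to_mem F n X : chain_to F n X -> F X.
Proof. by case. Qed.

Lemma strict_chainP F n : strict_chain F n <-> exists X, chain_to F n X.
Proof.
split=> [[C [CF Clt]]|[X cX]].
  exists (C n); elim: n CF Clt => [|n IH] CF Clt.
    by apply: chain_to0; exact: CF.
  apply: chain_toS (IH _ _) _ _; last exact: Clt.
  - by move=> i ?; apply: CF; exact: leqW.
  - by move=> i ?; apply: Clt; exact: leqW.
  - exact: CF.
suff [C [_ CF]] : exists C : nat -> set R, C n = X /\
    (forall i, (i <= n)%N -> F (C i)) /\
    (forall i, (i < n)%N -> C i `<` C i.+1) by exists C.
elim: cX => [{}X FX|{}n {}X Y _ [C [CX [CF Clt]]] FY XY].
  by exists (fun=> X).
exists (fun i => if (i <= n)%N then C i else Y); rewrite ltnn; split=> //; split=> i.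
  by case: ifP => [ile _|//]; exact: CF.
rewrite ltnS => ile; rewrite ile; move: ile; rewrite leq_eqVlt => /orP[/eqP ->|ilt].
  by rewrite ltnn CX.
by rewrite ilt; exact: Clt.
Qed.

Definition climb A := chain_to (fun B => ideal B /\ A `<=` B).

Lemma climb_ideal A n X : climb A n X -> ideal X.
Proof. by move=> /chain_to_mem[]. Qed.

Lemma climb_sub A n X : climb A n X -> A `<=` X.
Proof. by move=> /chain_to_mem[]. Qed.

Lemma climb0 A X : ideal X -> A `<=` X -> climb A 0 X.
Proof. by move=> iX AX; apply: chain_to0. Qed.

Lemma climbS A n X Y : climb A n X -> ideal Y -> X `<` Y -> climb A n.+1 Y.
Proof.
move=> cX iY XY; apply: (chain_toS cX _ XY); split=> // a.
by move=> /(climb_sub cX) /XY.1.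
Qed.

Lemma climb_weaken A n X Y : climb A n X -> ideal Y -> X `<=` Y -> climb A n Y.
Proof.
case=> [{}X [iX AX] iY XY|{}n Z {}X cZ [iX _] ZX iY XY].
  by apply: climb0 => // a /AX /XY.
apply: climbS cZ iY _; split; first by move=> a /ZX.1 /XY.
by move=> YZ; apply: ZX.2 => a /XY /YZ.
Qed.

Lemma climb_antimono A B n X : A `<=` B -> climb B n X -> climb A n X.
Proof.
move=> AB; elim=> [{}X [iX BX]|{}n {}X Y _ cX [iY _] XY]; last exact: climbS cX iY XY.
by apply: climb0 => // a /AB /BX.
Qed.

Lemma climb_cat A B n k X Y :
  climb A n X -> X `<=` B -> climb B k Y -> climb A (n + k) Y.
Proof.
move=> cX XB; elim=> [{}Y [iY BY]|{}k {}Y Z _ IH [iZ _] YZ].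
  by rewrite addn0; apply: climb_weaken cX iY _ => a /XB /BY.
by rewrite addnS; exact: climbS IH iZ YZ.
Qed.

Definition finite_colen A := exists N, forall n X, climb A n X -> (n <= N)%N.

(** The length of [R/A]; the default 0 is only reached when the chains of ideals
    above [A] have unbounded length. *)
Definition colen A : nat :=
  xget 0%N [set N | (exists X, climb A N X) /\
                    forall n X, climb A n X -> (n <= N)%N].

Lemma colenP A : finite_colen A ->
  (exists X, climb A (colen A) X) /\ forall n X, climb A n X -> (n <= colen A)%N.
Proof.
case=> N ub; apply: (@xgetPex _ 0%N [set N | (exists X, climb A N X) /\
  forall n X, climb A n X -> (n <= N)%N]).
have ex0 : exists n, `[< exists X, climb A n X >].
  exists 0%N; apply/asboolP; exists setT; exact: climb0.
have ub' n : `[< exists X, climb A n X >] -> (n <= N)%N.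
  by move=> /asboolP[X /ub].
case: (ex_maxnP ex0 ub') => n /asboolP cn max; exists n; split=> // k X ck.
by apply: max; apply/asboolP; exists X.
Qed.

Lemma colen_geP A n X : finite_colen A -> climb A n X -> (n <= colen A)%N.
Proof. by move=> /colenP[_]; apply. Qed.

Lemma colen_le A N :
  (forall n X, climb A n X -> (n <= N)%N) -> (colen A <= N)%N.
Proof.
by move=> ub; have [|[X /ub]] // := @colenP A; exists N.
Qed.

Lemma finite_colenS A B : A `<=` B -> finite_colen A -> finite_colen B.
Proof.
by move=> AB [N ub]; exists N => n X /(climb_antimono AB); exact: ub.
Qed.

Lemma colenS A B : A `<=` B -> finite_colen A -> (colen B <= colen A)%N.
Proof.
move=> AB fA; apply: colen_le => n X /(climb_antimono AB).
exact: colen_geP.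
Qed.

Lemma climbT n X : climb setT n X -> n = 0%N.
Proof.
by case=> // k Y {}X cY _ [_ []] x _; exact: (climb_sub cY).
Qed.

Lemma finite_colenT : finite_colen [set: R].
Proof. by exists 0%N => n X /climbT ->. Qed.

Lemma colenT : colen [set: R] = 0%N.
Proof. by apply/eqP; rewrite -leqn0; apply: colen_le => n X /climbT ->. Qed.

(** By the modular law, a strict inclusion [X < Y] stays strict in
    [X + (v) <= Y + (v)] or in [(X : v) <= (Y : v)]. *)
Lemma climb_split A v n X : climb A n X ->
  exists n1 n2, [/\ (n <= n1 + n2)%N, climb (adjoin A v) n1 (adjoin X v)
    & climb (colon A v) n2 (colon X v)].
Proof.
elim=> [{}X [iX AX]|{}n {}X Y cX [n1 [n2 [le c1 c2]]] [iY _] XY].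
  exists 0%N, 0%N; split=> //; apply: climb0 => //.
  - exact: adjoin_ideal.
  - exact: adjoinS.
  - exact: colon_ideal.
  - exact: colonS.
have iX := climb_ideal cX.
have [YX|nYX] := pselect (adjoin Y v `<=` adjoin X v); last first.
  exists n1.+1, n2; split; first by rewrite addSn ltnS.
    by apply: climbS c1 (adjoin_ideal _ iY) _; split=> //; apply: adjoinS XY.1.
  by apply: climb_weaken c2 (colon_ideal _ iY) _; apply: colonS XY.1.
exists n1, n2.+1; split; first by rewrite addnS ltnS.
  by apply: climb_weaken c1 (adjoin_ideal _ iY) _; apply: adjoinS XY.1.
apply: climbS c2 (colon_ideal _ iY) _; split; first by apply: colonS XY.1.
move=> cYX; apply: XY.2 => y Yy.
have [x [r [Xx yE]]] := YX _ (sub_adjoin v Yy).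
have Xrv : X (r * v).
  apply: cYX; rewrite /colon /=; apply: (ideal_DKl iY (XY.1 _ Xx)).
  by rewrite -yE.
by rewrite yE; apply: ideal_D.
Qed.

Definition scaled_add A v (D : set R) : set R :=
  [set y | exists a r, [/\ A a, D r & y = a + r * v]].

Lemma scaled_add_ideal A v D : ideal A -> ideal D -> ideal (scaled_add A v D).
Proof.
move=> iA iD; split.
- by exists 0, 0; split; [exact: ideal_0|exact: ideal_0|ring].
- move=> _ _ [a [r [Aa Dr ->]]] [b [t [Ab Dt ->]]].
  by exists (a + b), (r + t); split; [exact: ideal_D|exact: ideal_D|ring].
- move=> c _ [a [r [Aa Dr ->]]].
  by exists (c * a), (c * r); split; [exact: ideal_M|exact: ideal_M|ring].
Qed.

(** The ideals between [A] and [A + (v)] include the [A + D v] for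
    [D] above [A : v], and [D] is recovered as [(A + D v) : v]. *)
Lemma climb_scale A v n D : ideal A ->
  climb (colon A v) n D -> climb A n (scaled_add A v D).
Proof.
move=> iA; elim=> [{}D [iD _]|{}n {}D E cD IH [iE _] DE].
  apply: climb0; first exact: scaled_add_ideal.
  by move=> a Aa; exists a, 0; split=> //; [exact: ideal_0|ring].
have iD := climb_ideal cD.
apply: climbS IH (scaled_add_ideal _ iA iE) _; split.
  by move=> _ [a [r [Aa /DE.1 Er ->]]]; exists a, r.
move=> ED; apply: DE.2 => e Ee.
have [|a [r [Aa Dr eE]]] := ED (e * v).
  by exists 0, e; split=> //; [exact: ideal_0|ring].
apply: (ideal_BKr iD Dr); apply: (climb_sub cD); rewrite /colon /=.
by rewrite mulrBl eE addrK.
Qed.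

Lemma finite_colen_split A v :
  finite_colen (adjoin A v) -> finite_colen (colon A v) -> finite_colen A.
Proof.
move=> [N1 ub1] [N2 ub2]; exists (N1 + N2)%N => n X.
move=> /(climb_split v)[n1 [n2 [le /ub1 le1 /ub2 le2]]].
by apply: leq_trans le _; exact: leq_add.
Qed.

(** Additivity of length in the exact sequence
    [0 -> R/(A : v) -> R/A -> R/(A + (v)) -> 0]. *)
Lemma colen_split A v : ideal A ->
  finite_colen (adjoin A v) -> finite_colen (colon A v) ->
  colen A = (colen (adjoin A v) + colen (colon A v))%N.
Proof.
move=> iA f1 f2; have fA := finite_colen_split f1 f2.
apply/eqP; rewrite eqn_leq; apply/andP; split.
  apply: colen_le => n X /(climb_split v)[n1 [n2 [le c1 c2]]].
  by apply: leq_trans le _; apply: leq_add; exact: colen_geP c1 || exact: colen_geP c2.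
have [[X cX] _] := colenP f1; have [[Y cY] _] := colenP f2.
rewrite addnC; apply: colen_geP fA _.
  apply: climb_cat (climb_scale iA cY) _ cX.
by move=> _ [a [r [Aa _ ->]]]; exists a, r.
Qed.

Lemma colen_adjoin_le A v : ideal A -> finite_colen A ->
  (colen A <= colen (adjoin A v) + colen (colon A v))%N.
Proof.
move=> iA fA; rewrite (colen_split (v := v)) //.
  by apply: finite_colenS fA; exact: sub_adjoin.
by apply: finite_colenS fA; exact: sub_colon.
Qed.

End Colength.

Lemma fine_length_quot (K : realType) (R : comNzRingType) (A : set R) :
  finite_colen A -> fine (length_quot K A) = (colen A)%:R.
Proof.
move=> fA; have [[X cX] ub] := colenP fA.
suff -> : length_quot K A = (colen A)%:R%:E by [].
apply/eqP; rewrite eq_le; apply/andP; split.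
  apply: ge_ereal_sup => _ [n /strict_chainP[Y /ub le] <-].
  by rewrite lee_fin ler_nat.
by apply: ereal_sup_ubound; exists (colen A) => //; apply/strict_chainP; exists X.
Qed.

(** * Associated primes and prime avoidance *)

Section NoetherianRing.
Variable R : comNzRingType.
Implicit Types (A B P Q : set R) (x y v w : R) (s : seq R).
Implicit Types (Ps As : seq (set R)).

Lemma ideal_chain_union (C : nat -> set R) : (forall n, ideal (C n)) ->
  (forall n, C n `<=` C n.+1) -> ideal (\bigcup_n C n).
Proof.
move=> iC CS.
have C_le i j : (i <= j)%N -> C i `<=` C j.
  move=> /subnKC <-; elim: (j - i)%N => [|k IH]; first by rewrite addn0.
  by rewrite addnS => x /IH /CS.
split; first by exists 0%N => //; exact: ideal_0.
- move=> x y [i _ Cx] [j _ Cy]; exists (maxn i j) => //.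
  apply: ideal_D => //; [exact: C_le (leq_maxl _ _) _ Cx|].
  exact: C_le (leq_maxr _ _) _ Cy.
- by move=> a x [i _ Cx]; exists i => //; exact: ideal_M.
Qed.

(** Noetherian induction. If it failed, iterating the choice of a larger
    counterexample would give a strictly increasing sequence of ideals, whose
    union is finitely generated and hence one of its members. *)
Lemma noetherian_ind (Pr : set R -> Prop) : noetherian R ->
  (forall A, ideal A -> (forall B, ideal B -> A `<` B -> Pr B) -> Pr A) ->
  forall A, ideal A -> Pr A.
Proof.
move=> noeth step A0 iA0; apply: contrapT => nA0.
pose T := {A | ideal A /\ ~ Pr A}.
have next (t : T) : {t' : T | sval t `<` sval t'}.
  case: t => A [iA nA] /=; apply: cid; apply: contrapT => no; apply: nA.
  apply: step => // B iB AB; apply: contrapT => nB; apply: no.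
  by exists (exist _ B (conj iB nB)).
pose C n := iter n (fun t => sval (next t)) (exist _ A0 (conj iA0 nA0) : T).
pose U := \bigcup_n sval (C n).
have CS n : sval (C n) `<` sval (C n.+1) by rewrite /C iterS; case: (next _).
have C_le i j : (i <= j)%N -> sval (C i) `<=` sval (C j).
  move=> /subnKC <-; elim: (j - i)%N => [|k IH]; first by rewrite addn0.
  by rewrite addnS => x /IH /(CS _).1.
have iU : ideal U.
  by apply: ideal_chain_union => n; [case: (C n) => ? []|exact: (CS n).1].
have [n [x UE]] := noeth _ iU.
have [k Ck] : exists k, forall i, sval (C k) (x i).
  have /choice[f fP] i : exists k, sval (C k) (x i).
    have [k _ Ck] : U (x i) by rewrite UE; apply: sub_ideal_gen; exists i.
    by exists k.
  exists (\max_i f i) => i; apply: C_le (fP i).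
  exact: leq_bigmax.
apply: (CS k).2; apply: (@subset_trans _ U); first by move=> y Cy; exists k.+1.
rewrite UE; apply: ideal_gen_sub; first by case: (C k) => ? [].
by move=> _ [i _ <-].
Qed.

(** [x] is a nonzerodivisor on [R/A]. *)
Definition nzd A x : Prop := forall y, A (x * y) -> A y.

Definition associated A P : Prop := prime_ideal P /\ exists v, P = colon A v.

Lemma prime_ideal_ideal P : prime_ideal P -> ideal P. Proof. by case. Qed.

Lemma prime_ideal_expr P x k : prime_ideal P -> P (x ^+ k) -> P x.
Proof.
case=> _ P1 Pmul; elim: k => [/P1 //|k IH].
by rewrite exprS => /Pmul[].
Qed.

Lemma associated_nzd A P x : associated A P -> nzd A x -> ~ P x.
Proof.
move=> [[iP P1 _] [v PE]] nx; rewrite PE /colon /= => /nx Av.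
by apply: P1; rewrite PE /colon /= mul1r.
Qed.

Lemma sub_associated A P : ideal A -> associated A P -> A `<=` P.
Proof. by move=> iA [_ [v ->]]; exact: sub_colon. Qed.

Lemma adjoin_proper A v : ideal A -> ~ A v -> A `<` adjoin A v.
Proof.
by move=> iA Av; split; [exact: sub_adjoin|move=> /(_ _ (mem_adjoin v iA))].
Qed.

(** A maximal annihilator among those of the nonzero multiples of [w] is
    prime. *)
Lemma exists_prime_colon A w : noetherian R -> ideal A -> ~ A w ->
  exists r, prime_ideal (colon A (r * w)).
Proof.
move=> noeth iA.
suff main B : ideal B -> forall w, colon A w = B -> ~ A w ->
    exists r, prime_ideal (colon A (r * w)).
  by apply: main (colon_ideal w iA) _ erefl.
move: B; apply: (noetherian_ind noeth) => B _ IH {}w BE Aw.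
have [Pw|nPw] := pselect (prime_ideal (colon A w)).
  by exists 1; rewrite mul1r.
have [x [y [Axy Ax Ay]]] : exists x y, [/\ A (x * y * w), ~ A (x * w) & ~ A (y * w)].
  apply: contrapT => no; apply: nPw; split; first exact: colon_ideal.
    by rewrite /colon /= mul1r.
  move=> x y Axy; apply: contrapT => /not_orP[Ax Ay]; apply: no.
  by exists x, y.
have [||||r Pr] := IH (colon A (y * w)) _ _ (y * w) => //.
- exact: colon_ideal.
- rewrite -BE; split.
    by rewrite /colon => r /= Ar; rewrite mulrCA; exact: ideal_M.
  by move=> /(_ x); rewrite /colon /= mulrA => /(_ Axy).
- by exists (r * y); rewrite -mulrA.
Qed.

Lemma not_nzd_associated A x : noetherian R -> ideal A -> ~ nzd A x ->
  exists2 P, associated A P & P x.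
Proof.
move=> noeth iA /existsNP[y /not_implyP[Axy Ay]].
have [r Pr] := exists_prime_colon noeth iA Ay.
exists (colon A (r * y)); first by split=> //; exists (r * y).
by rewrite /colon /= mulrCA; exact: ideal_M.
Qed.

(** A filtration of [R/A] with factors [R/P], for [P] in the list. The list
    contains all the associated primes of [A], and every prime above [A]
    contains one of its members. *)
Inductive prime_filtration : seq (set R) -> set R -> Prop :=
| prime_filtration_nil : prime_filtration [::] setT
| prime_filtration_cons P Ps A v : prime_ideal P -> colon A v = P ->
    prime_filtration Ps (adjoin A v) -> prime_filtration (P :: Ps) A.

Lemma exists_prime_filtration A : noetherian R -> ideal A ->
  exists Ps, prime_filtration Ps A.
Proof.
move=> noeth; move: A; apply: (noetherian_ind noeth) => A iA IH.
have [A1|A1] := pselect (A 1).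
  by rewrite (ideal_eqT iA A1); exists [::]; constructor.
have [v] := exists_prime_colon noeth iA A1; rewrite mulr1 => Pv.
have [||Ps FPs] := IH (adjoin A v); first exact: adjoin_ideal.
  apply: adjoin_proper => // Av; have [_ + _] := Pv.
  by rewrite /colon /= mul1r.
by exists (colon A v :: Ps); apply: prime_filtration_cons FPs.
Qed.

Lemma prime_filtration_prime Ps A P : prime_filtration Ps A -> P \in Ps ->
  prime_ideal P.
Proof.
elim=> // {}P' {}Ps {}A v PP' _ _ IH.
by rewrite inE => /orP[/eqP ->|].
Qed.

Lemma prime_filtration_above Ps A P : prime_filtration Ps A -> ideal A ->
  P \in Ps -> A `<=` P.
Proof.
elim=> // {}P' {}Ps {}A v _ PE _ IH iA.
rewrite inE => /orP[/eqP ->|/(IH (adjoin_ideal v iA)) AP a Aa].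
  by rewrite -PE; exact: sub_colon.
by apply: AP; exact: sub_adjoin.
Qed.

Lemma prime_filtration_sub Ps A Q : prime_filtration Ps A -> prime_ideal Q ->
  A `<=` Q -> exists2 P, P \in Ps & P `<=` Q.
Proof.
move=> F PQ; elim: F => [TQ|P {}Ps {}A v PP PE _ IH AQ].
  by have [_ Q1 _] := PQ; case: Q1; exact: TQ.
have [Qv|Qv] := pselect (Q v).
  have [|P' P'Ps P'Q] := IH; last by exists P' => //; rewrite inE P'Ps orbT.
  by apply: adjoin_sub => //; exact: prime_ideal_ideal.
exists P; first exact: mem_head.
by rewrite -PE => r /AQ; have [_ _ Qmul] := PQ; move=> /Qmul[].
Qed.

(** Let [Q = A : w]. If some multiple of [w] is nonzero modulo [A] and lies in
    [A + (v)], then [Q] is the annihilator of a nonzero element of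
    [(A + (v))/A], a copy of [R/P], and so [Q = P]. Otherwise [Q] is still the
    annihilator of [w] modulo [A + (v)]. *)
Lemma prime_filtration_associated Ps A Q : prime_filtration Ps A -> ideal A ->
  associated A Q -> Q \in Ps.
Proof.
elim=> [_ [[_ Q1 _] [w QE]]|P {}Ps {}A v PP PE _ IH iA [PQ [w QE]]].
  by case: Q1; rewrite QE.
have [_ Q1 Qmul] := PQ; rewrite inE.
have [[r [Ar [a [t [Aa rwE]]]]]|no] :=
    pselect (exists r, ~ A (r * w) /\ adjoin A v (r * w)).
  suff -> : Q = P by rewrite eqxx.
  have Qr : ~ Q r by rewrite QE.
  have tE x : A (x * (r * w)) <-> P (x * t).
    rewrite rwE mulrDr -PE /colon /= mulrA; split=> [|h].
      by apply: ideal_DKl => //; exact: ideal_M.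
    by apply: ideal_D => //; exact: ideal_M.
  have Pt : ~ P t by move=> Pt; apply: Ar; rewrite -[_ * w]mul1r tE mul1r.
  have [iP P1 Pmul] := PP.
  apply/seteqP; split=> x.
    rewrite {1}QE /colon /= => Axw.
    have /tE/Pmul[//|//] : A (x * (r * w)) by rewrite mulrCA; exact: ideal_M.
  move=> Px; have : A (x * (r * w)) by apply/tE; exact: ideal_Mr.
  rewrite mulrA; change (colon A w (x * r) -> Q x).
  by rewrite -QE => /Qmul[].
apply/orP; right; apply: IH; first exact: adjoin_ideal.
split=> //; exists w; rewrite QE; apply/seteqP; split=> x.
  by apply: colonS; exact: sub_adjoin.
by move=> Bx; apply: contrapT => nx; apply: no; exists x.
Qed.

Lemma finite_associated As : noetherian R -> (forall A, A \in As -> ideal A) ->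
  exists Ps, forall P, P \in Ps <-> exists2 A, A \in As & associated A P.
Proof.
move=> noeth; elim: As => [_|A As IH iAs].
  by exists [::] => P; split=> // -[].
have [|Ps PsP] := IH; first by move=> B BAs; apply: iAs; rewrite inE BAs orbT.
have iA : ideal A by apply: iAs; exact: mem_head.
have [Qs FQs] := exists_prime_filtration noeth iA.
exists ([seq Q <- Qs | `[< associated A Q >]] ++ Ps) => P.
rewrite mem_cat mem_filter; split.
  case/orP=> [/andP[/asboolP AP _]|/PsP[B BAs BP]].
    by exists A => //; exact: mem_head.
  by exists B => //; rewrite inE BAs orbT.
case=> B; rewrite inE => /orP[/eqP ->|BAs] BP; apply/orP; last first.
  by right; apply/PsP; exists B.
left; apply/andP; split; first exact/asboolP.
exact: prime_filtration_associated FQs iA BP.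
Qed.

Lemma prime_product_witness B Ps P : ideal B -> prime_ideal P -> ~ B `<=` P ->
  (forall Q, Q \in Ps -> ideal Q /\ ~ Q `<=` P) ->
  exists z, [/\ B z, ~ P z & forall Q, Q \in Ps -> Q z].
Proof.
move=> iB PP /existsNP[b /not_implyP[Bb Pb]].
elim: Ps => [_|Q Ps IH h]; first by exists b.
have [|z [Bz Pz Psz]] := IH; first by move=> S SPs; apply: h; rewrite inE SPs orbT.
have [iQ /existsNP[y /not_implyP[Qy Py]]] := h _ (mem_head _ _).
exists (y * z); split; first exact: ideal_M.
  by have [_ _ Pmul] := PP; move=> /Pmul[].
move=> S; rewrite inE => /orP[/eqP ->|SPs]; first exact: ideal_Mr.
by apply: ideal_M (Psz _ SPs); case: (h S) => //; rewrite inE SPs orbT.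
Qed.

(** Prime avoidance in a coset [x + B]: in an irredundant list, move an element
    that avoids all primes but [P] by an element of [B] that lies in all of
    them but [P]. *)
Lemma prime_avoidance B x Ps : ideal B -> (forall P, P \in Ps -> prime_ideal P) ->
  (forall P, P \in Ps -> ~ (P x /\ B `<=` P)) ->
  exists2 y, B y & forall P, P \in Ps -> ~ P (x + y).
Proof.
move=> iB; have [n] := ubnP (size Ps); elim: n Ps => // n IH [_ _ _|P Ps ltn PPs nPs].
  by exists 0 => //; exact: ideal_0.
have PP := PPs _ (mem_head _ _); have iP := prime_ideal_ideal PP.
have [[Q QPs QP]|irr] := pselect (exists2 Q, Q \in Ps & Q `<=` P).
  have sub S : S \in P :: rem Q Ps -> S \in P :: Ps.
    by rewrite !inE => /orP[->//|/mem_rem ->]; rewrite orbT.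
  have [||| y By yP] := IH (P :: rem Q Ps).
  - rewrite /= size_rem // prednK; first exact: ltn.
    by case: (Ps) QPs.
  - by move=> S /sub /PPs.
  - by move=> S /sub /nPs.
  exists y => // S; rewrite inE (perm_mem (perm_to_rem QPs)) inE.
  case/or3P=> [/eqP -> | /eqP -> /QP | Sr].
  - by apply: yP; exact: mem_head.
  - by apply: yP; exact: mem_head.
  - by apply: yP; rewrite inE Sr orbT.
have sub S : S \in Ps -> S \in P :: Ps by rewrite inE orbC => ->.
have [||| y By yP] := IH Ps.
- exact: ltn.
- by move=> S /sub /PPs.
- by move=> S /sub /nPs.
have [Pxy|Pxy] := pselect (P (x + y)); last first.
  by exists y => // S; rewrite inE => /orP[/eqP ->|/yP].
have BP : ~ B `<=` P.
  move=> BP; apply: (nPs P (mem_head _ _)); split=> //.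
  by apply: (@ideal_BKr _ P x (- y)) => //; 
    [apply: ideal_N => //; exact: BP|rewrite opprK].
have [|z [Bz Pz Psz]] := @prime_product_witness B Ps P iB PP BP.
  move=> Q QPs; split; first by apply: prime_ideal_ideal; apply: PPs; apply: sub.
  by move=> QP; apply: irr; exists Q.
exists (y + z) => [|S]; first exact: ideal_D.
rewrite addrA inE => /orP[/eqP -> Pxyz|SPs Sxyz].
  by apply: Pz; apply: ideal_DKl iP Pxy Pxyz.
have iS : ideal S by apply: prime_ideal_ideal; apply: PPs; apply: sub.
apply: (yP S SPs); apply: (@ideal_BKr _ S _ (- z)) => //.
  by apply: ideal_N => //; exact: Psz.
by rewrite opprK.
Qed.

(** Simultaneous avoidance of the zero divisors on several quotients of [R], in
    a coset [x + B]. *)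
Lemma exists_nzd B x As : noetherian R -> ideal B ->
  (forall A, A \in As -> ideal A) ->
  (forall A P, A \in As -> associated A P -> ~ (P x /\ B `<=` P)) ->
  exists2 y, B y & forall A, A \in As -> nzd A (x + y).
Proof.
move=> noeth iB iAs h; have [Ps PsP] := finite_associated noeth iAs.
have [||y By yP] := @prime_avoidance B x Ps iB.
- by move=> P /PsP[A _ []].
- by move=> P /PsP[A AAs AP]; exact: h AP.
exists y => // A AAs; apply: contrapT.
move=> /(not_nzd_associated noeth (iAs _ AAs))[P AP].
by apply: yP; apply/PsP; exists A.
Qed.

End NoetherianRing.

(** * Regular sequences in local rings *)

Section LocalRing.
Variables (R : comNzRingType) (m : set R).
Hypotheses (noeth : noetherian R) (locR : local_ring m).
Implicit Types (A B P Q : set R) (x y v w : R) (s : seq R).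

Lemma local_ideal : ideal m. Proof. by case: locR => -[]. Qed.
Lemma local_proper : ~ m 1. Proof. by case: locR => -[]. Qed.

Lemma local_maximal A : ideal A -> ~ A 1 -> m `<=` A -> A = m.
Proof. by case: locR => -[_ _ h] _; exact: h. Qed.

Lemma proper_sub_local A : ideal A -> ~ A 1 -> A `<=` m.
Proof.
move: A; apply: (noetherian_ind noeth) => A iA IH A1.
have [[B [iB AB B1]]|no] := pselect (exists B, [/\ ideal B, A `<` B & ~ B 1]).
  by move=> x /AB.1; exact: IH.
suff -> : A = m by [].
case: locR => _; apply; split=> // B iB B1 AB.
apply: contrapT => BA; apply: no; exists B; split=> //; split=> // BsubA.
by apply: BA; apply/seteqP.
Qed.

Lemma local_prime : prime_ideal m.
Proof.
split; [exact: local_ideal|exact: local_proper|move=> x y mxy].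
apply: contrapT => /not_orP[mx my]; apply: local_proper.
have im := local_ideal.
have [a [r [ma rE]]] : adjoin m x 1.
  apply: contrapT => h; apply: mx.
  rewrite -(local_maximal (adjoin_ideal x im) h (@sub_adjoin _ m x)).
  exact: mem_adjoin.
case: my; rewrite -[y]mul1r rE mulrDl -mulrA.
by apply: ideal_D => //; [exact: ideal_Mr|exact: ideal_M].
Qed.

Lemma finite_colen_local : finite_colen m.
Proof.
exists 1%N => n X cX.
suff [-> //|[-> //]] : n = 0%N \/ n = 1%N /\ X 1.
elim: cX => [|{}n {}X Y cX IH [iY _] XY]; first by left.
have iX := climb_ideal cX; right.
case: IH => [->|[_ X1]]; last by case: (XY.2); rewrite (ideal_eqT iX X1).
split=> //; apply: contrapT => Y1; apply: (XY.2).
have mX := climb_sub cX; rewrite (local_maximal iY Y1) //.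
by move=> z /mX /XY.1.
Qed.

(** All the factors [R/P] of a prime filtration of [R/A] are copies of the
    residue field. *)
Lemma finite_colen_only_prime A : ideal A ->
  (forall P, prime_ideal P -> A `<=` P -> P = m) -> finite_colen A.
Proof.
move: A; apply: (noetherian_ind noeth) => A iA IH only.
have [A1|A1] := pselect (A 1); first by rewrite (ideal_eqT iA A1); exact: finite_colenT.
have [v] := exists_prime_colon noeth iA A1; rewrite mulr1 => Pv.
apply: (@finite_colen_split _ A v).
  apply: IH; first exact: adjoin_ideal.
    apply: adjoin_proper => // Av; have [_ + _] := Pv.
    by rewrite /colon /= mul1r.
  by move=> P PP /(subset_trans (@sub_adjoin _ A v)); exact: only.
rewrite (only _ Pv (sub_colon v iA)).
exact: finite_colen_local.
Qed.

Lemma finite_colen_expr A : ideal A ->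
  (forall z, m z -> exists k, A (z ^+ k)) -> finite_colen A.
Proof.
move=> iA mA; apply: finite_colen_only_prime => // P PP AP.
have [iP P1 _] := PP; apply: local_maximal => // z /mA[k /AP].
exact: prime_ideal_expr.
Qed.

Fixpoint regseq A s : Prop :=
  if s is v :: s' then nzd A v /\ regseq (adjoin A v) s' else True.

Definition depth_ge A n : Prop :=
  exists s, [/\ size s = n, (forall v, v \in s -> m v) & regseq A s].

Lemma depth_geS A n : depth_ge A n.+1 <->
  exists z, [/\ m z, nzd A z & depth_ge (adjoin A z) n].
Proof.
split=> [[[|z s] [sn ms rs]]|[z [mz nz [s [sn ms rs]]]]]; first by [].
  move: sn rs => [sn] [nz rs]; exists z; split=> //; first by apply: ms; exact: mem_head.
  by exists s; split=> // v vs; apply: ms; rewrite inE vs orbT.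
exists (z :: s); split=> [|v|//]; first by rewrite /= sn.
by rewrite inE => /orP[/eqP ->|/ms].
Qed.

Lemma not_sub_associated A P z : m z -> nzd A z -> associated A P -> ~ m `<=` P.
Proof. by move=> mz nz AP mP; apply: (associated_nzd AP nz); exact: mP. Qed.

(** Exchange in the bottom case: if [m v] lies in [A + (u)], then [z v = u w]
    modulo [A], and [m w] lies in [A + (z)]. *)
Lemma associated_exchange A u z : ideal A -> nzd A u -> nzd A z -> m z ->
  associated (adjoin A u) m -> exists2 w, m `<=` colon (adjoin A z) w & ~ adjoin A z w.
Proof.
move=> iA nu nz mz [_ [v mE]].
have Auv : ~ adjoin A u v.
  by move=> h; apply: local_proper; rewrite mE /colon /= mul1r.
have [a [w [Aa zvE]]] : adjoin A u (z * v) by move: mz; rewrite mE.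
exists w => [b|[a' [w' [Aa' wE]]]].
  rewrite {1}mE => -[a'' [t [Aa'' bvE]]].
  exists (b * w - t * z), t; split; last by ring.
  apply: nu; have -> : u * (b * w - t * z) = z * a'' - b * a.
    have uE : w * u = z * v - a by rewrite zvE; ring.
    have -> : u * (b * w - t * z) = b * (w * u) - z * (t * u) by ring.
    have -> : t * u = b * v - a'' by rewrite bvE; ring.
    by rewrite uE; ring.
  by apply: ideal_B => //; exact: ideal_M.
apply: Auv; exists (v - w' * u), w'; split; last by ring.
apply: nz; have -> : z * (v - w' * u) = a + u * a'.
  have -> : z * (v - w' * u) = z * v - w' * z * u by ring.
  by rewrite zvE wE; ring.
by apply: ideal_D => //; exact: ideal_M.
Qed.

Lemma nzd_adjoin_swap A z c : ideal A -> nzd A z -> nzd (adjoin A z) c ->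
  nzd (adjoin A c) z.
Proof.
move=> iA nz nc y [a [w [Aa zyE]]].
have [a' [w' [Aa' wE]]] : adjoin A z w.
  apply: nc; exists (- a), y; split; first exact: ideal_N.
  by rewrite [y * z]mulrC zyE; ring.
exists (y - w' * c), w'; split; last by ring.
apply: nz; have -> : z * (y - w' * c) = a + c * a'.
  have -> : z * (y - w' * c) = z * y - w' * z * c by ring.
  by rewrite zyE wE; ring.
by apply: ideal_D => //; exact: ideal_M.
Qed.

(** Dividing by a nonzerodivisor [u] of [m] lowers the depth by at most one.
    Given a regular sequence that starts with [z], some [c] in [m] is regular on
    [R/A], [R/(A + (z))] and [R/(A + (u))]. The induction hypothesis replaces
    the rest of the sequence by one that starts with [c]; modulo [c] it then
    replaces [z] by [u]. *)
Lemma depth_ge_adjoin n A u : ideal A -> m u -> nzd A u ->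
  depth_ge A n.+1 -> depth_ge (adjoin A u) n.
Proof.
elim: n A u => [|n IH] A u iA mu nu; first by move=> _; exists [::].
move=> /depth_geS[z [mz nz Dz]].
have iz := adjoin_ideal z iA; have iu := adjoin_ideal u iA.
have mzAss P : associated (adjoin A z) P -> ~ m `<=` P.
  move: Dz => /depth_geS[z' [mz' nz' _]].
  exact: not_sub_associated nz'.
have muAss P : associated (adjoin A u) P -> ~ m `<=` P.
  move=> AP mP; have [iP P1 _] := AP.1.
  rewrite (local_maximal iP P1 mP) in AP.
  have [w mw Aw] := associated_exchange iA nu nz mz AP.
  have [r Pr] := exists_prime_colon noeth iz Aw.
  apply: (mzAss (colon (adjoin A z) (r * w))); first by split=> //; exists (r * w).
  by move=> b /mw h; rewrite /colon /= mulrCA; exact: ideal_M.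
have [||c mc nc] := @exists_nzd R m 0 [:: A; adjoin A z; adjoin A u] noeth local_ideal.
- by move=> B; rewrite !inE => /or3P[] /eqP ->.
- move=> B P; rewrite !inE => /or3P[] /eqP -> AP [_ mP].
  + exact: (not_sub_associated mz nz AP).
  + exact: (mzAss P).
  + exact: (muAss P).
rewrite add0r in nc.
have ncA : nzd A c by apply: nc; rewrite mem_head.
have ncz : nzd (adjoin A z) c by apply: nc; rewrite !inE eqxx orbT.
have ncu : nzd (adjoin A u) c by apply: nc; rewrite !inE eqxx !orbT.
have ic := adjoin_ideal c iA.
apply/depth_geS; exists c; split=> //.
rewrite adjoinAC //; apply: (IH) => //; first exact: nzd_adjoin_swap ncu.
apply/depth_geS; exists z; split=> //; first exact: nzd_adjoin_swap ncz.
by rewrite adjoinAC //; exact: IH.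
Qed.

(** If the depth of [R/A] is at least the number of generators of an [m]-primary
    ideal over [A], the ideal is generated over [A] by a regular sequence: no
    associated prime of [A] contains it, so that prime avoidance in the coset of
    [x] modulo the other generators turns [x] into a nonzerodivisor. *)
Lemma regular_parameters n A s : ideal A -> size s = n ->
  (forall v, v \in s -> m v) -> depth_ge A n ->
  (forall z, m z -> exists k, adjoins A s (z ^+ k)) ->
  exists s', [/\ size s' = n, regseq A s' & adjoins A s' = adjoins A s].
Proof.
elim: n A s => [|n IH] A s iA; first by move=> /size0nil -> _ _ _; exists [::].
case: s => // x s [sn] ms D mA.
have [z [mz nz _]] := (depth_geS A n).1 D.
pose B := adjoins [set 0] s.
have iB : ideal B by apply: adjoins_ideal; exact: ideal_zero.
have [||y By ny] := @exists_nzd R B x [:: A] noeth iB.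
- by move=> C; rewrite inE => /eqP ->.
- move=> C P; rewrite inE => /eqP -> AP [Px BP].
  have iP := prime_ideal_ideal AP.1.
  have [k Ak] := mA _ mz; apply: (associated_nzd AP nz).
  apply: (prime_ideal_expr (k := k) AP.1); move: Ak.
  apply: adjoins_sub => //.
    exact: sub_associated AP.
  move=> v; rewrite inE => /orP[/eqP -> //|vs].
  by apply: BP; apply: mem_adjoins => //; exact: ideal_zero.
have {}ny : nzd A (x + y) by apply: ny; exact: mem_head.
have ms' v : v \in s -> m v by move=> vs; apply: ms; rewrite inE vs orbT.
have mxy : m (x + y).
  apply: ideal_D; [exact: local_ideal|by apply: ms; exact: mem_head|].
  move: By; apply: adjoins_sub => //; first exact: local_ideal.
  by move=> _ ->; apply: ideal_0; exact: local_ideal.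
have ia v : ideal (adjoins (adjoin A v) s) by apply: adjoins_ideal; exact: adjoin_ideal.
have BE v : B `<=` adjoins (adjoin A v) s.
  apply: adjoins_sub => // [_ ->|w]; first exact: ideal_0.
  by apply: mem_adjoins; exact: adjoin_ideal.
have AE v : A `<=` adjoins (adjoin A v) s.
  by move=> a /(@sub_adjoin _ A v); exact: sub_adjoins.
have vE v : adjoins (adjoin A v) s v.
  by apply: sub_adjoins; exact: mem_adjoin.
have E : adjoins (adjoin A (x + y)) s = adjoins (adjoin A x) s.
  apply/seteqP; split; (apply: adjoins_sub => //; last first);
    try (by move=> v; apply: mem_adjoins; exact: adjoin_ideal);
    apply: adjoin_sub => //.
    by apply: ideal_D => //; exact: BE.
  by rewrite -[x](addrK y); apply: ideal_B => //; rewrite ?addrK //; exact: BE.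
have [|//||s' [s'n rs' s'E]] := IH (adjoin A (x + y)) s (adjoin_ideal _ iA) sn.
- exact: ms'.
- exact: depth_ge_adjoin.
- by move=> w /mA[k Ak]; exists k; rewrite E.
by exists (x + y :: s'); split; rewrite /= ?s'n // s'E.
Qed.

Lemma regseq_nthP A s : regseq A s <->
  forall i, (i < size s)%N -> nzd (adjoins A (take i s)) (nth 0 s i).
Proof.
elim: s A => [|v s IH] A //=; split=> [[nv /IH h] [|i] //|h].
  by rewrite ltnS => /h.
by split; [exact: (h 0%N)|apply/IH => i ilt; exact: (h i.+1)].
Qed.

Lemma regular_sequence_depth n (x : 'I_n -> R) :
  regular_sequence m x -> depth_ge [set 0] n.
Proof.
move=> [mx rx]; exists [seq x i | i <- enum 'I_n]; split.
- by rewrite size_map size_enum_ord.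
- by move=> _ /mapP[i _ ->].
apply/regseq_nthP => i; rewrite size_map size_enum_ord => ilt.
rewrite (nth_map (Ordinal ilt)) ?size_enum_ord // -ideal_gen_seq.
have xE : nth (Ordinal ilt) (enum 'I_n) i = Ordinal ilt.
  by apply: val_inj; rewrite /= nth_enum_ord.
rewrite xE => y; have := rx (Ordinal ilt) y => /=.
suff -> : [set x j | j in [set j : 'I_n | (j < i)%N]] =
    [set v | v \in take i [seq x j | j <- enum 'I_n]] by [].
apply/seteqP; split=> v /=.
  case=> j ji <-; rewrite -map_take; apply: map_f.
  by rewrite -(nth_ord_enum j j) -(nth_take _ ji) mem_nth // size_takel //
    ?size_enum_ord // ltnW.
rewrite -map_take => /mapP[j jt ->]; exists j => //.
have jt' : index j (take i (enum 'I_n)) = j.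
  rewrite -[RHS](index_enum_ord j).
  by rewrite -[in RHS](cat_take_drop i (enum 'I_n)) index_cat jt.
rewrite /= -jt' -[X in (_ < X)%N](@size_takel i _ (enum 'I_n)) ?index_mem //.
by rewrite size_enum_ord ltnW.
Qed.

End LocalRing.

(** * Powers of an ideal generated by a regular sequence *)

Section TruncatedPowers.
Variable R : comNzRingType.
Implicit Types (A B C D E L : set R) (x y v w : R) (s : seq R).

(** [R/A] has a filtration with [n] factors isomorphic to [R/C]. *)
Inductive filtered C : nat -> set R -> Prop :=
| filtered_nil : filtered C 0 setT
| filtered_cons n A v : ideal A -> filtered C n (adjoin A v) -> colon A v = C ->
    filtered C n.+1 A.

Lemma colen_filtered C n A : finite_colen C -> filtered C n A ->
  finite_colen A /\ colen A = (n * colen C)%N.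
Proof.
move=> fC; elim=> [|{}n {}A v iA _ [fA cA] AvE].
  by rewrite colenT; split=> //; exact: finite_colenT.
split; first by apply: (finite_colen_split fA); rewrite AvE.
by rewrite (colen_split iA fA) AvE // cA mulSn addnC.
Qed.

Lemma nzd_filtered C n A x : nzd C x -> filtered C n A -> nzd A x.
Proof.
move=> nx; elim=> [//|{}n {}A v iA _ IH AvE y Axy].
have [a [r [Aa yE]]] := IH _ (sub_adjoin v Axy).
have : C r.
  apply: nx; rewrite -AvE /colon /= -mulrA.
  apply: (ideal_DKl (x := x * a) iA); first exact: ideal_M.
  by rewrite -mulrDr -yE.
by rewrite -AvE /colon /= yE => Arv; exact: ideal_D.
Qed.

Lemma adjoinT x : adjoin [set: R] x = setT.
Proof. by apply/seteqP; split=> // y _; exact: sub_adjoin. Qed.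

(** When [x] is regular on the factors [R/C], tensoring with [R/(x)] keeps the
    filtration exact, and its factors become [R/(C + (x))]. *)
Lemma filtered_adjoin C n A x : nzd C x -> filtered C n A ->
  filtered (adjoin C x) n (adjoin A x).
Proof.
move=> nx; elim=> [|{}n {}A v iA FA IH AvE].
  by rewrite adjoinT; constructor.
apply: (filtered_cons (v := v)); first exact: adjoin_ideal.
  by rewrite adjoinAC.
apply/seteqP; split=> r; last first.
  case=> c [t [+ ->]]; rewrite -AvE /colon /= => Acv.
  by exists (c * v), (t * v); split=> //; ring.
move=> [a [w [Aa rvE]]].
have [a' [w' [Aa' wE]]] : adjoin A v w.
  apply: (nzd_filtered nx FA); exists (- a), r; split; first exact: ideal_N.
  by rewrite rvE; ring.
exists (r - w' * x), w'; split; last by ring.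
rewrite -AvE /colon /=; have -> : (r - w' * x) * v = a + x * a'.
  by rewrite mulrBl rvE wE; ring.
by apply: ideal_D => //; exact: ideal_M.
Qed.

(** [R/L] is an extension of [R/(L + (x))] by [x R/L], a copy of [R/(L : x)]. *)
Lemma filtered_cat D L x n1 n2 : ideal L ->
  filtered D n1 (adjoin L x) -> filtered D n2 (colon L x) ->
  filtered D (n2 + n1) L.
Proof.
move=> iL F1 F2.
have LE : scaled_add L x (colon L x) = L.
  apply/seteqP; split=> [_ [a [r [La Lr ->]]]|a La]; first exact: ideal_D.
  by exists a, 0; split=> //; [exact: (ideal_0 (colon_ideal _ iL))|ring].
rewrite -[X in filtered _ _ X]LE.
have : colon L x `<=` colon L x by [].
move: {1 3 4}(colon L x) F2 => E; elim=> [_|{}n2 {}E v iE _ IH EvE LE'].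
  rewrite add0n; suff -> : scaled_add L x setT = adjoin L x by [].
  apply/seteqP; split=> y [a [r]]; last by case=> La ->; exists a, r.
  by case=> La _ ->; exists a, r.
rewrite addSn; apply: (filtered_cons (v := v * x)).
- exact: scaled_add_ideal.
- have -> : adjoin (scaled_add L x E) (v * x) = scaled_add L x (adjoin E v).
    apply/seteqP; split=> [_ [_ [t [[a [r [La Er ->]]] ->]]]|].
      by exists a, (r + t * v); split=> //; [exists r, t|ring].
    move=> _ [a [_ [La [r [t [Er ->]]] ->]]].
    by exists (a + r * x), t; split; [exists a, r|ring].
  by apply: IH => r /LE'; exact: sub_adjoin.
- rewrite -EvE; apply/seteqP; split=> r; last first.
    move=> Erv; exists 0, (r * v); split=> //; first exact: ideal_0.
    by rewrite mulrA add0r.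
  move=> [a [e [La Ee rE]]]; rewrite /colon /=.
  apply: (ideal_BKr iE Ee); apply: LE'; rewrite /colon /=.
  by rewrite mulrBl -mulrA rE addrK.
Qed.

(** The sum of the ideals [x^i B (n - i)] for [i < a] and of [(x^a)]. It is
    written in Horner form because its colon by [x] is then the same ideal for
    [a - 1] and [n - 1]. *)
Fixpoint layered x (B : nat -> set R) (a n : nat) : set R :=
  if a is a'.+1 then scaled_add (B n) x (layered x B a' n.-1) else setT.

Section Layered.
Variables (x : R) (B : nat -> set R).
Hypothesis iB : forall n, ideal (B n).

Lemma layered_ideal a n : ideal (layered x B a n).
Proof.
by elim: a n => [|a IH] n; [exact: ideal_setT|exact: scaled_add_ideal].
Qed.

Lemma sub_layered a n : B n `<=` layered x B a n.
Proof.
case: a => [//|a] b Bb; exists b, 0; split=> //; last by ring.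
exact: (ideal_0 (layered_ideal _ _)).
Qed.

Lemma layered0 a : B 0%N = setT -> layered x B a 0 = setT.
Proof.
by move=> B0; apply/seteqP; split=> // y _; apply: sub_layered; rewrite B0.
Qed.

Lemma layered_expr a n : layered x B a n (x ^+ a).
Proof.
elim: a n => [//|a IH] n; exists 0, (x ^+ a); split=> //; first exact: ideal_0.
by rewrite exprSr add0r.
Qed.

Lemma layeredS a n : layered x B a.+1 n `<=` layered x B a n.
Proof.
elim: a n => [//|a IH] n _ [b [r [Bb /IH ar ->]]].
by exists b, r.
Qed.

Lemma layered_mul_var a n w : layered x B a n w -> layered x B a n.+1 (x * w).
Proof.
case: a => [//|a] /layeredS aw; exists 0, w; split=> //; first exact: ideal_0.
by rewrite mulrC add0r.
Qed.

Lemma layered_mul u a n w : B 0%N = setT ->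
  (forall k b, B k b -> B k.+1 (u * b)) ->
  layered x B a n w -> layered x B a n.+1 (u * w).
Proof.
move=> B0 uB; elim: a n w => [//|a IH] n _ [b [r [/uB Bb ar ->]]].
exists (u * b), (u * r); split=> //; last by ring.
by case: n ar {Bb} => [_|n /IH //]; rewrite /= layered0.
Qed.

(** The summand [B n] gives the factor [R/(B n + (x))] of the quotient, and what
    remains is the quotient for [a - 1] and [n - 1]. Regularity of [x] on
    [R/(B n)] is what makes the colon by [x] no larger than that. *)
Lemma filtered_layered C (c : nat -> nat) a n : (forall k, B k.+1 `<=` B k) ->
  (forall k, filtered C (c k) (B k)) -> nzd C x ->
  filtered (adjoin C x) (\sum_(k < a) c (n - k)%N)%N (layered x B a n).
Proof.
move=> BS FB nx; elim: a n => [|a IH] n; first by rewrite big_ord0; constructor.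
have Bpred : B n `<=` layered x B a n.-1.
  by case: n => [|n]; [exact: sub_layered|move=> b /BS; exact: sub_layered].
rewrite big_ord_recl subn0 addnC.
apply: (@filtered_cat _ _ x); first exact: layered_ideal.
  suff -> : adjoin (layered x B a.+1 n) x = adjoin (B n) x by exact: filtered_adjoin.
  apply/seteqP; split; last by apply: adjoinS; exact: sub_layered.
  apply: adjoin_sub; [exact: adjoin_ideal| |exact: mem_adjoin].
  by move=> _ [b [r [Bb _ ->]]]; exists b, r.
have -> : colon (layered x B a.+1 n) x = layered x B a n.-1.
  apply/seteqP; split=> y; last first.
    move=> ay; exists 0, y; split=> //; first exact: ideal_0.
    by rewrite add0r.
  move=> [b [r [Bb ar yxE]]]; apply: (ideal_BKr (layered_ideal _ _) ar).
  apply: Bpred; apply: (nzd_filtered nx (FB n)).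
  by rewrite mulrC mulrBl yxE addrK.
have -> : (\sum_(i < a) c (n - bump 0 i) = \sum_(i < a) c (n.-1 - i))%N.
  by apply: eq_bigr => i _; congr c; rewrite /bump /= -subn1 -subnDA.
exact: IH.
Qed.

End Layered.

(** The ideal [J^n + (x^q : x in s)] for [J] generated by [s], sorted by the
    powers of the first element of [s]. *)
Fixpoint trunc_power s (n q : nat) : set R :=
  if s is x :: s' then layered x (fun k => trunc_power s' k q) q n
  else if n is 0%N then setT else [set 0].

(** The number of monomials of degree less than [n] in [d] variables, all of
    whose exponents are less than [q]. *)
Fixpoint trunc_count (d n q : nat) : nat :=
  if d is d'.+1 then (\sum_(k < q) trunc_count d' (n - k) q)%N else (0 < n)%N.

Lemma trunc_power_ideal s n q : ideal (trunc_power s n q).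
Proof.
elim: s n => [|x s IH] n; last exact: layered_ideal.
by case: n => [|n]; [exact: ideal_setT|exact: ideal_zero].
Qed.

Lemma trunc_power0 s q : trunc_power s 0 q = setT.
Proof.
elim: s => [//|x s IH] /=.
exact: (layered0 x (fun k => trunc_power_ideal s k q) q IH).
Qed.

Lemma trunc_power_mul s n q u w : u \in s -> trunc_power s n q w ->
  trunc_power s n.+1 q (u * w).
Proof.
have iT s' k : ideal (trunc_power s' k q) by exact: trunc_power_ideal.
elim: s n w => //= x s IH n w; rewrite inE => /orP[/eqP ->|us].
  exact: layered_mul_var.
apply: layered_mul => //; first exact: trunc_power0.
by move=> k b; exact: IH.
Qed.

Lemma trunc_power_pow s n q u : u \in s -> trunc_power s n q (u ^+ q).
Proof.
elim: s n => //= x s IH n; rewrite inE => /orP[/eqP ->|us].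
  by apply: layered_expr => k; exact: trunc_power_ideal.
by apply: sub_layered => [k|]; [exact: trunc_power_ideal|exact: IH].
Qed.

Lemma sub_trunc_power s n q :
  ideal_exp (adjoins [set 0] s) n `<=` trunc_power s n q.
Proof.
elim: n => [|n IH]; first by rewrite trunc_power0.
apply: ideal_mul_sub => [|a b Ja /IH Tb]; first exact: trunc_power_ideal.
have iT := trunc_power_ideal s n.+1 q.
apply: (@adjoins_sub _ _ (colon (trunc_power s n.+1 q) b) _ _ _ _ _ Ja).
- exact: colon_ideal.
- by move=> _ ->; rewrite /colon /= mul0r; exact: ideal_0.
- by move=> v vs; exact: trunc_power_mul.
Qed.

Lemma trunc_powerS s n q : trunc_power s n.+1 q `<=` trunc_power s n q.
Proof.
have iT k s' : ideal (trunc_power s' k q) by exact: trunc_power_ideal.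
elim: s n => [|x s IH] n /=; first by case: n => [|n] y.
elim: {2 4}q n => [//|a IHa] n _ [b [r [/IH Bb ar ->]]].
exists b, r; split=> //; case: n ar {Bb} => [_|n /IHa //] /=.
by rewrite layered0 // trunc_power0.
Qed.

(** Quantifying over [A] drives the recursion on [s]: after each division by [x]
    the induction hypothesis is applied to the colon ideal [A : x]. *)
Lemma trunc_power_sub s n q A : ideal A ->
  ideal_exp (adjoins [set 0] s) n `<=` A -> (forall u, u \in s -> A (u ^+ q)) ->
  trunc_power s n q `<=` A.
Proof.
elim: s n A => [|x s IH] n A iA JA sA.
  by case: n JA => [//|n] _ _ ->; exact: ideal_0.
have i0 : ideal [set 0 : R] by exact: ideal_zero.
set J := adjoins _ _ in JA.
have Jx : J x by apply: mem_adjoins => //; exact: mem_head.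
have sJ : adjoins [set 0] s `<=` J.
  rewrite /J /= adjoins_adjoin //; exact: sub_adjoin.
have {}sA' u : u \in s -> A (u ^+ q) by move=> us; apply: sA; rewrite inE us orbT.
have {sA} := sA x (mem_head _ _) => /=.
elim: {2 4}q n A iA JA sA' => [|a IHa] n A iA JA sA xA.
  by rewrite (ideal_eqT iA) //; rewrite expr0 in xA.
move=> _ [b [r [Bb ar ->]]]; apply: ideal_D => //.
  by move: Bb; apply: IH => // y /(ideal_expS sJ) /JA.
move: ar; apply: (IHa _ (colon A x)) => [|y Jy|u us|].
- exact: colon_ideal.
- apply: JA; move: Jy; case: (n) => [//|k] Jy.
  by rewrite mulrC; apply: ideal_mulM.
- by apply: ideal_Mr => //; exact: sA.
- by rewrite /colon /= -exprSr.
Qed.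

Lemma regseq_rcons A s v :
  regseq A (rcons s v) <-> regseq A s /\ nzd (adjoins A s) v.
Proof.
elim: s A => [|w s IH] A /=; first by split=> -[].
by split=> [[nw /IH[]]|[[nw rs] nv]] //; split=> //; apply/IH.
Qed.

(** The filtration by monomials: when [s] is a regular sequence, each monomial
    outside the ideal contributes a copy of [R/J]. The sequence is read
    backwards because the variable split off first must be regular on the
    quotient by all the others. *)
Lemma filtered_trunc_power s n q : regseq [set 0] (rev s) ->
  filtered (adjoins [set 0] (rev s)) (trunc_count (size s) n q) (trunc_power s n q).
Proof.
elim: s n => [|x s IH] n.
  move=> _; case: n => [|n]; first exact: filtered_nil.
  have i0 : ideal [set 0 : R] by exact: ideal_zero.
  apply: (filtered_cons (v := 1)) => //=.
    by rewrite (ideal_eqT (adjoin_ideal _ i0)); [constructor|exact: mem_adjoin].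
  by apply/seteqP; split=> r; rewrite /colon /= mulr1.
rewrite rev_cons => /regseq_rcons[rs nx]; rewrite adjoins_rcons /=.
apply: (@filtered_layered x (fun k => trunc_power s k q) _ _
  (fun k => trunc_count (size s) k q)) nx => k.
- exact: trunc_power_ideal.
- exact: trunc_powerS.
- exact: IH.
Qed.

(** [R/(A + (y^k))] is filtered by the powers of [y], with [k] factors that are
    quotients of [R/(A + (y))]. *)
Lemma colen_adjoin_expr A y k : ideal A -> finite_colen (adjoin A y) ->
  finite_colen (adjoin A (y ^+ k)) /\
  (colen (adjoin A (y ^+ k)) <= k * colen (adjoin A y))%N.
Proof.
move=> iA fA; elim: k => [|k [fk ck]].
  rewrite expr0 (ideal_eqT (adjoin_ideal _ iA)); last exact: mem_adjoin.
  by rewrite colenT; split=> //; exact: finite_colenT.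
set B := adjoin A (y ^+ k.+1).
have iB : ideal B by exact: adjoin_ideal.
have s1 : adjoin A (y ^+ k) `<=` adjoin B (y ^+ k).
  by apply: adjoinS; exact: sub_adjoin.
have s2 : adjoin A y `<=` colon B (y ^+ k).
  apply: adjoin_sub; first exact: colon_ideal.
    by move=> a Aa; apply: ideal_Mr => //; exact: sub_adjoin.
  by rewrite /colon /= -exprS; exact: mem_adjoin.
have f1 := finite_colenS s1 fk; have f2 := finite_colenS s2 fA.
split; first exact: finite_colen_split f1 f2.
rewrite (colen_split iB f1 f2) mulSn addnC.
by apply: leq_add; [exact: colenS|apply: leq_trans ck; exact: colenS].
Qed.

Lemma colen_adjoins_expr A s k : ideal A -> finite_colen (adjoins A s) ->
  finite_colen (adjoins A [seq y ^+ k | y <- s]) /\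
  (colen (adjoins A [seq y ^+ k | y <- s]) <= k ^ size s * colen (adjoins A s))%N.
Proof.
elim: s A => [|y s IH] A iA /=; first by rewrite mul1n.
rewrite adjoins_adjoin // => fA.
have [f1 c1] := colen_adjoin_expr k (adjoins_ideal s iA) fA.
rewrite -adjoins_adjoin // in f1 c1.
have [f2 c2] := IH _ (adjoin_ideal _ iA) f1; split=> //.
apply: leq_trans c2 _; rewrite expnSr -mulnA leq_mul2l; apply/orP; right.
exact: c1.
Qed.

End TruncatedPowers.

(** * Dimension, reductions and Frobenius powers *)

Section Bounds.
Variables (R : comNzRingType) (m : set R).
Hypotheses (noeth : noetherian R) (locR : local_ring m).
Implicit Types (A B E I J P Q : set R) (c x y z : R) (s gs : seq R).

Lemma m_primary_ideal J : m_primary m J -> ideal J.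
Proof. by case=> -[]. Qed.

Lemma m_primary_expr J z : m_primary m J -> m z -> exists k, J (z ^+ k).
Proof. by case=> _ <-. Qed.

Lemma m_primary_sub J : m_primary m J -> J `<=` m.
Proof. by case=> _ <- x Jx; exists 1%N. Qed.

Lemma m_primary_prime J P : m_primary m J -> prime_ideal P -> J `<=` P -> P = m.
Proof.
move=> mJ PP JP; have [iP P1 _] := PP; apply: (local_maximal locR) => //.
by move=> z /(m_primary_expr mJ)[k /JP]; exact: prime_ideal_expr.
Qed.

Lemma finite_colen_powers J A k : m_primary m J -> ideal A ->
  (forall u, J u -> A (u ^+ k)) -> finite_colen A.
Proof.
move=> mJ iA JA; apply: (finite_colen_expr noeth locR) => // z mz.
by have [j Jz] := m_primary_expr mJ mz; exists (j * k)%N; rewrite exprM; exact: JA.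
Qed.

(** A prime that contains [c] is not minimal. Each [y] is then chosen outside the
    finitely many primes, other than [m], of a prime filtration of the current
    quotient; so every prime that contains [y] and the previous ideal is [m] or
    lies strictly above a prime that contains the previous ideal. *)
Lemma raise_height J c k : m_primary m J ->
  (forall P, minimal_prime P -> ~ P c) ->
  exists ys, [/\ size ys = k, (forall y, y \in ys -> J y) &
    forall Q, prime_ideal Q -> adjoins (adjoin [set 0] c) ys `<=` Q ->
      Q = m \/ chain_to (@prime_ideal R) k.+1 Q].
Proof.
move=> mJ cmin; have i0 : ideal [set 0 : R] by exact: ideal_zero.
have iJ := m_primary_ideal mJ.
elim: k => [|k [ys [sys Jys hys]]].
  exists [::]; split=> //= Q PQ cQ; right.
  have Qc : Q c by apply: cQ; exact: mem_adjoin.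
  have [Q' [PQ' Q'Q ne]] : exists Q', [/\ prime_ideal Q', Q' `<=` Q & Q' <> Q].
    apply: contrapT => no; apply: (cmin Q) Qc; split=> // Q' PQ' Q'Q.
    by apply: contrapT => ne; apply: no; exists Q'.
  apply: (chain_toS (chain_to0 PQ')) => //; split=> // QQ'.
  by apply: ne; apply/seteqP.
set A := adjoins _ _ in hys.
have iA : ideal A by apply/adjoins_ideal/adjoin_ideal.
have [Ps FPs] := exists_prime_filtration noeth iA.
have [||y Jy yP] := @prime_avoidance R J 0 [seq P <- Ps | P != m] iJ.
- by move=> P; rewrite mem_filter => /andP[_ /(prime_filtration_prime FPs)].
- move=> P; rewrite mem_filter => /andP[/eqP Pm /(prime_filtration_prime FPs) PP].
  by case=> _ /(m_primary_prime mJ PP).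
exists (rcons ys y); split; first by rewrite size_rcons sys.
  by move=> x; rewrite mem_rcons inE => /orP[/eqP ->|/Jys].
rewrite adjoins_rcons => Q PQ AQ.
have [iQ Q1 _] := PQ.
have [P PPs PQs] := prime_filtration_sub FPs PQ (subset_trans (@sub_adjoin _ A y) AQ).
have PP := prime_filtration_prime FPs PPs.
have [Pm|Pm] := pselect (P = m).
  by left; apply: (local_maximal locR) => //; rewrite -Pm.
have [//|cP] := hys P PP (prime_filtration_above FPs iA PPs).
right; apply: (chain_toS cP PQ); split=> // QP.
apply: (yP P); first by rewrite mem_filter PPs andbT; apply/eqP.
by rewrite add0r; apply: QP; apply: AQ; exact: mem_adjoin.
Qed.

(** With [d - 1] such elements a prime other than [m] would have height at least
    [d], and the chain could be continued to [m]. *)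
Lemma finite_colen_parameters J c d : m_primary m J -> (0 < d)%N ->
  krull_dim_is R d -> (forall P, minimal_prime P -> ~ P c) ->
  exists ys, [/\ size ys = d.-1, (forall y, y \in ys -> J y) &
    finite_colen (adjoins (adjoin [set 0] c) ys)].
Proof.
move=> mJ d0 [_ dimle] cmin.
have [ys [sys Jys hys]] := raise_height d.-1 mJ cmin.
exists ys; split=> //; apply: (finite_colen_only_prime noeth locR).
  by apply/adjoins_ideal/adjoin_ideal/ideal_zero.
move=> Q PQ /(hys Q PQ)[//|]; rewrite prednK // => cQ.
apply: contrapT => Qm; have [iQ Q1 _] := PQ.
have Qsub := proper_sub_local noeth locR iQ Q1.
suff : (d.+1 <= d)%N by rewrite ltnn.
apply: dimle; apply/strict_chainP; exists m.
apply: (chain_toS cQ (local_prime locR)); split=> // mQ.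
by apply: Qm; apply: (local_maximal locR).
Qed.

Lemma colen_adjoins_le E gs : ideal E -> finite_colen E ->
  (colen E <= colen (adjoins E gs) + \sum_(g <- gs) colen (colon E g))%N.
Proof.
elim: gs E => [|g gs IH] E iE fE /=; first by rewrite big_nil addn0.
have sE := @sub_adjoin _ E g.
rewrite big_cons addnCA addnC.
apply: leq_trans (colen_adjoin_le g iE fE) _; rewrite leq_add2r.
apply: leq_trans (IH _ (adjoin_ideal g iE) (finite_colenS sE fE)) _.
rewrite leq_add2l; apply: leq_sum => h _; apply: colenS; first exact: colonS.
by apply: finite_colenS fE; exact: sub_colon.
Qed.

(** [I^(n+1) = J I^n] gives [I^(n+k) = J^k I^n]. *)
Lemma reduction_exp J I : reduction J I ->
  exists n0, forall k, ideal_exp I (n0 + k) `<=` ideal_exp J k.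
Proof.
move=> [iJ JI [n redE]]; exists n => k.
suff : ideal_exp I (n + k) `<=` ideal_mul (ideal_exp J k) (ideal_exp I n).
  move=> h x /h; apply: ideal_mul_sub; first exact: ideal_exp_ideal.
  by move=> a b Ja _; apply: ideal_Mr => //; exact: ideal_exp_ideal.
elim: k => [|k IH].
  by rewrite addn0 => x Ix; rewrite -[x]mul1r; apply: ideal_mulM.
rewrite addnS; set L := ideal_mul _ _.
have iL : ideal L by exact: ideal_mul_ideal.
apply: ideal_mul_sub => // a b Ia /IH JIb.
rewrite mulrC; apply: (@ideal_mul_sub _ _ _ (colon L a) _ _ _ JIb).
  exact: colon_ideal.
move=> u w Ju Iw; rewrite /colon /=.
have Jaw : ideal_mul J (ideal_exp I n) (a * w) by rewrite -redE; exact: ideal_mulM.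
have -> : u * w * a = a * w * u by ring.
apply: (@ideal_mul_sub _ _ _ (colon L u) _ _ _ Jaw); first exact: colon_ideal.
move=> g v Jg Iv; rewrite /colon /= mulrAC; apply: ideal_mulM => //.
exact: ideal_mulM.
Qed.

Lemma mu_quotP I B : ideal I -> image_generated_by I B (mu_quot I B).
Proof.
move=> iI.
have ex : exists n, `[< image_generated_by I B n >].
  have [n [x IE]] := noeth iI; exists n; apply/asboolP; exists x.
  by split; [rewrite IE; exact: sub_ideal_gen|rewrite {1}IE].
apply: (proj1 (@xgetPex _ 0%N [set n | image_generated_by I B n /\
    forall k, image_generated_by I B k -> (n <= k)%N] _)).
case: (ex_minnP ex) => n /asboolP gn min; exists n; split=> // k gk.
by apply: min; apply/asboolP.
Qed.

Section Frobenius.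
Variables (p d : nat) (J : set R).
Hypotheses (charR : p \in [pchar R]) (d_gt0 : (0 < d)%N).
Hypotheses (dimR : krull_dim_is R d) (mJ : m_primary m J).

(** Additivity of the Frobenius makes [q]-th powers testable on generators. *)
Lemma frobenius_ideal E e : ideal E -> ideal [set y | E (y ^+ (p ^ e)%N)].
Proof.
move=> iE; split=> /= [|x y Ex Ey|a x Ex].
- by rewrite expr0n expn_eq0 gtn_eqF ?(prime_gt0 (pcharf_prime charR)) //; exact: ideal_0.
- rewrite exprDn_pchar; first exact: ideal_D.
  by rewrite pnatX (pnatE _ (pcharf_prime charR)) charR.
- by rewrite exprMn; exact: ideal_M.
Qed.

Lemma frobenius_power_pow A e x : A x -> frobenius_power p A e (x ^+ (p ^ e)%N).
Proof. by move=> Ax; apply: sub_ideal_gen; exists x. Qed.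

Lemma frobenius_power_sub A E e : ideal E ->
  (forall x, A x -> E (x ^+ (p ^ e)%N)) -> frobenius_power p A e `<=` E.
Proof. by move=> iE AE; apply: ideal_gen_sub => // _ [x Ax <-]; exact: AE. Qed.

Lemma frobenius_power_ideal A e : ideal (frobenius_power p A e).
Proof. exact: ideal_gen_ideal. Qed.

Lemma add_frobenius_ideal A B n e :
  ideal (ideal_add (ideal_exp A n) (frobenius_power p B e)).
Proof.
by apply: ideal_add_ideal; [exact: ideal_exp_ideal|exact: frobenius_power_ideal].
Qed.

Lemma sub_add_frobenius A B n e :
  frobenius_power p B e `<=` ideal_add (ideal_exp A n) (frobenius_power p B e).
Proof. by apply: ideal_add_subr; exact: ideal_exp_ideal. Qed.

Lemma finite_colen_frobenius E e : ideal E -> frobenius_power p J e `<=` E ->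
  finite_colen E.
Proof.
move=> iE JE; apply: (finite_colen_powers (k := (p ^ e)%N) mJ iE) => u Ju.
by apply: JE; exact: frobenius_power_pow.
Qed.

(** If [c g^q] lies in [J^[q]], then [J^[q] : g^q] contains [c] and the [q]-th
    powers of the [d - 1] elements of [J] that complete [c] to an ideal of
    finite colength; hence the order [q^(d-1)]. *)
Lemma colen_tight_closure g : tight_closure p J g ->
  exists C e0, forall e E, (e0 <= e)%N -> ideal E -> frobenius_power p J e `<=` E ->
    (colen (colon E (g ^+ (p ^ e))) <= C * (p ^ e) ^ d.-1)%N.
Proof.
move=> [c [cmin [e0 ce]]].
have [ys [sys Jys fys]] := finite_colen_parameters mJ d_gt0 dimR cmin.
exists (colen (adjoins (adjoin [set 0] c) ys)), e0 => e E le iE JE.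
have i0 : ideal [set 0 : R] by exact: ideal_zero.
have [f1 c1] := colen_adjoins_expr (p ^ e) (adjoin_ideal c i0) fys.
apply: leq_trans (_ : (_ <= colen (adjoins (adjoin [set 0%R] c)
  [seq y ^+ (p ^ e)%N | y <- ys]))%N) _; last by rewrite mulnC -sys.
apply: colenS f1; have iC := colon_ideal (g ^+ (p ^ e)%N) iE.
apply: adjoins_sub => //.
  apply: adjoin_sub => //; first by move=> _ ->; exact: ideal_0.
  by apply: JE; exact: ce.
move=> _ /mapP[y /Jys Jy ->]; apply: sub_colon => //; apply: JE.
exact: frobenius_power_pow.
Qed.

Lemma colen_tight_closure_sum gs : (forall g, g \in gs -> tight_closure p J g) ->
  exists C e0, forall e E, (e0 <= e)%N -> ideal E -> frobenius_power p J e `<=` E ->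
    (\sum_(g <- gs) colen (colon E (g ^+ (p ^ e))) <= C * (p ^ e) ^ d.-1)%N.
Proof.
elim: gs => [_|g gs IH Jgs]; first by exists 0%N, 0%N => e E *; rewrite big_nil.
have [|C1 [e1 h1]] := IH; first by move=> h hs; apply: Jgs; rewrite inE hs orbT.
have [C2 [e2 h2]] := colen_tight_closure (Jgs _ (mem_head _ _)).
exists (C2 + C1)%N, (maxn e1 e2) => e E; rewrite geq_max => /andP[le1 le2] iE JE.
by rewrite big_cons mulnDl; apply: leq_add; [exact: h2|exact: h1].
Qed.

(** Adding to [E = I^n + J^[q]] the [q]-th powers of generators of [I] modulo
    the tight closure of [J], and of elements of the tight closure that make up
    the difference, gives an ideal above [I^n + I^[q]]. A generator [f] is in
    [I], so that [E : f^q] contains [I^(n-q) + J^[q]]; an element of the tight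
    closure only costs a term of order [q^(d-1)]. *)
Lemma colen_frobenius_le I : ideal I -> J `<=` I ->
  exists C e0, forall e n, (e0 <= e)%N -> (p ^ e <= n)%N ->
    (colen (ideal_add (ideal_exp I n) (frobenius_power p J e)) <=
     colen (ideal_add (ideal_exp I n) (frobenius_power p I e)) +
     mu_quot I (tight_closure p J) *
       colen (ideal_add (ideal_exp I (n - p ^ e)) (frobenius_power p J e)) +
     C * (p ^ e) ^ d.-1)%N.
Proof.
move=> iI JI; set mu := mu_quot _ _.
have [f [fI IfE]] : image_generated_by I (tight_closure p J) mu by exact: mu_quotP.
have tc0 : tight_closure p J 0.
  exists 1; split=> [P [[]] //|]; exists 0%N => e _.
  rewrite mul1r; apply: (ideal_0 (frobenius_ideal e (frobenius_power_ideal J e))).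
have [n [h IE]] := noeth iI.
have /choice[g gP] j : exists g, tight_closure p J g /\ ideal_gen (range f) (h j - g).
  have : ideal_add I (tight_closure p J) (h j).
    exists (h j); last by exists 0 => //; rewrite addr0.
    by rewrite IE; apply: sub_ideal_gen; exists j.
  by rewrite IfE => -[a fa [b Jb <-]]; exists b; rewrite addrK.
pose fs := [seq f i | i <- enum 'I_mu]; pose gs := [seq g j | j <- enum 'I_n].
have [|C [e0 hC]] := @colen_tight_closure_sum gs.
  by move=> _ /mapP[j _ ->]; exact: (gP j).1.
exists C, e0 => e k le qk; set q := (p ^ e)%N.
set E := ideal_add _ (frobenius_power p J e).
have iE : ideal E by exact: add_frobenius_ideal.
have JE : frobenius_power p J e `<=` E by exact: sub_add_frobenius.
have IkE : ideal_exp I k `<=` E.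
  by apply: ideal_add_subl; exact: frobenius_power_ideal.
have fE : finite_colen E by exact: finite_colen_frobenius JE.
apply: leq_trans (colen_adjoins_le
  ([seq x ^+ q | x <- fs] ++ [seq x ^+ q | x <- gs]) iE fE) _.
set E' := adjoins E _.
have iE' : ideal E' by exact: adjoins_ideal.
rewrite big_cat -addnA; apply: leq_add; last first.
  apply: leq_add; last first.
  rewrite big_map; exact: hC.
  apply: leq_trans (_ : (\sum_(i <- enum 'I_mu) colen (ideal_add (ideal_exp I (k - q))
      (frobenius_power p J e)) <= _)%N); last first.
    by rewrite big_enum /= sum_nat_const card_ord.
  rewrite big_map big_map; apply: leq_sum => i _; apply: colenS.
    apply: ideal_add_sub; first exact: colon_ideal.
      move=> x Ix; apply: IkE; rewrite -(subnK qk); apply: ideal_expM => //.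
      by apply: ideal_exp_exp; apply: fI; exists i.
    by move=> x Jx; apply: sub_colon => //; exact: JE.
  apply: (@finite_colen_frobenius _ e); last exact: sub_add_frobenius.
  exact: add_frobenius_ideal.
apply: colenS; last first.
  apply: (@finite_colen_frobenius _ e).
    exact: add_frobenius_ideal.
  move=> x Jx; apply: sub_add_frobenius.
  apply: frobenius_power_sub Jx; first exact: frobenius_power_ideal.
  by move=> y /JI; exact: frobenius_power_pow.
apply: ideal_add_sub => //.
  by move=> x /IkE; exact: sub_adjoins.
apply: frobenius_power_sub => //.
have iF' := frobenius_ideal e iE'.
rewrite {1}IE; apply: ideal_gen_sub => // _ [j _ <-].
apply: (@ideal_BKr _ [set y | E' (y ^+ (p ^ e)%N)] _ (g j)) => //.
  rewrite /=; apply: mem_adjoins => //; rewrite mem_cat; apply/orP; right.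
  by apply: (map_f (fun x => x ^+ q)); apply: map_f; rewrite mem_enum.
apply: ideal_gen_sub (gP j).2 => // _ [i _ <-] /=.
apply: mem_adjoins => //; rewrite mem_cat; apply/orP; left.
by apply: (map_f (fun x => x ^+ q)); apply: map_f; rewrite mem_enum.
Qed.

End Frobenius.

End Bounds.

(** * Counting monomials *)

(** The number of monomials of degree less than [n] in [d] variables. *)
Definition monomial_count (d n : nat) : nat :=
  if n is n'.+1 then 'C(n' + d, d) else 0%N.

Lemma monomial_countS d n :
  monomial_count d.+1 n = (monomial_count d n + monomial_count d.+1 n.-1)%N.
Proof.
case: n => [//|[|n]] /=; first by rewrite !add0n !binn.
by rewrite addnS binS addnC addnS -addSn.
Qed.

Lemma sum_monomial_count d n a :
  (\sum_(k < a) monomial_count d (n - k) + monomial_count d.+1 (n - a))%N =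
  monomial_count d.+1 n.
Proof.
elim: a => [|a IH]; first by rewrite big_ord0 subn0.
by rewrite big_ord_recr /= -addnA subnS -monomial_countS.
Qed.

Lemma monomial_count_fact d n :
  (monomial_count d.+1 n * d.+1`! = \prod_(j < d.+1) (n + j))%N.
Proof.
case: n => [|n]; first by rewrite big_ord_recl addn0 mul0n.
rewrite /= bin_ffact; elim: d.+1 => {d}[|d IH]; first by rewrite big_ord0.
by rewrite addnS ffactSS IH big_ord_recr /= mulnC addSn.
Qed.

(** Inclusion and exclusion over the variables of exponent at least [q]. *)
Lemma trunc_countE (S : comNzRingType) d n q : (trunc_count d n q)%:R =
  \sum_(i < d.+1) (-1) ^+ i * 'C(d, i)%:R * (monomial_count d (n - i * q))%:R :> S.
Proof.
elim: d n => [|d IH] n.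
  rewrite big_ord1 /= expr0 bin0 mul0n subn0 !mul1r.
  by case: n => //= n; rewrite bin0.
pose G i : S := (monomial_count d.+1 (n - i * q))%:R.
pose a i : S := (-1) ^+ i * 'C(d, i)%:R.
have E i : \sum_(k < q) (monomial_count d (n - k - i * q))%:R = G i - G i.+1 :> S.
  apply/eqP; rewrite eq_sym subr_eq /G -(sum_monomial_count d (n - i * q) q).
  rewrite natrD natr_sum mulSn [(q + _)%N]addnC subnDA; apply/eqP; congr (_ + _).
  by apply: eq_bigr => k _; rewrite -!subnDA addnC.
transitivity (\sum_(i < d.+1) a i * (G i - G i.+1)).
  rewrite /= natr_sum (eq_bigr _ (fun (k : 'I_q) _ => IH (n - k)%N)) exchange_big /=.
  by apply: eq_bigr => i _; rewrite -mulr_sumr E.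
rewrite [RHS]big_ord_recl /= expr0 bin0 !mul1r.
rewrite (eq_bigr (fun i : 'I_d.+1 => a i * G i - a i * G i.+1)); last first.
  by move=> i _; rewrite mulrBr.
rewrite sumrB big_ord_recl /= {1}/a expr0 bin0 !mul1r -addrA; congr (_ + _).
have -> : \sum_(i < d) a (bump 0 i) * G (bump 0 i) = \sum_(i < d.+1) a i.+1 * G i.+1.
  have ad : a d.+1 = 0 by rewrite /a bin_small ?mulr0.
  by rewrite [RHS]big_ord_recr /= ad mul0r addr0.
rewrite -sumrB; apply: eq_bigr => i _.
by rewrite /a /G /bump /= add1n binS natrD exprS; ring.
Qed.

Lemma trunc_count_diag d n : trunc_count d n n = monomial_count d n.
Proof.
apply/eqP; rewrite -(eqr_nat int) trunc_countE big_ord_recl big1 => [|i _].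
  by rewrite expr0 bin0 mul0n subn0 !mul1r addr0.
by rewrite lift0 mulSn subnDA subnn sub0n mulr0.
Qed.

Section Asymptotics.
Variable K : realType.

Section Ratios.
Variable q : nat -> nat.
Hypothesis q_infty : ((q e)%:R : K) @[e --> \oo] --> +oo.

Lemma near_q_gt0 : \forall e \near \oo, 0 < (q e)%:R :> K.
Proof. exact: cvgry_gt. Qed.

Lemma cvg_inv_q : ((q e)%:R^-1 : K) @[e --> \oo] --> 0.
Proof. exact/(gtr0_cvgV0 near_q_gt0). Qed.

Lemma cvg_ratio (u : nat -> nat) (tau c : K) :
  (forall e, `|(u e)%:R - tau * (q e)%:R| <= c) ->
  ((u e)%:R / (q e)%:R : K) @[e --> \oo] --> tau.
Proof.
move=> uc; have cq0 : (c * (q e)%:R^-1) @[e --> \oo] --> (0 : K).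
  by rewrite -[X in _ --> X](mulr0 c); apply: cvgMl_tmp; exact: cvg_inv_q.
apply: (@squeeze_cvgr _ _ _ _ (fun e => tau - c * (q e)%:R^-1)
                              (fun e => tau + c * (q e)%:R^-1)).
- near=> e; have qe : 0 < (q e)%:R :> K by near: e; exact: near_q_gt0.
  rewrite -ler_distl -[X in _ - X](mulfK (lt0r_neq0 qe)) -mulrBl normrM.
  by rewrite [`|_^-1|]gtr0_norm ?invr_gt0 // ler_pM2r ?invr_gt0.
- by rewrite -[X in _ --> X]subr0; apply: cvgB => //; exact: cvg_cst.
- by rewrite -[X in _ --> X]addr0; apply: cvgD => //; exact: cvg_cst.
Unshelve. all: by end_near. Qed.

Lemma cvg_monomial_count d (u : nat -> nat) (tau c : K) : (0 < d)%N ->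
  (forall e, `|(u e)%:R - tau * (q e)%:R| <= c) ->
  ((monomial_count d (u e))%:R / (q e)%:R ^+ d : K) @[e --> \oo] -->
  tau ^+ d / d`!%:R.
Proof.
case: d => // d _ uc.
have fact_neq0 : (d.+1`!)%:R != 0 :> K by rewrite pnatr_eq0 -lt0n fact_gt0.
have countE e : (monomial_count d.+1 (u e))%:R / (q e)%:R ^+ d.+1 =
    (\prod_(j < d.+1) ((u e + j)%:R / (q e)%:R)) / (d.+1`!)%:R :> K.
  rewrite big_split /= prodr_const card_ord exprVn -natr_prod -monomial_count_fact.
  by rewrite natrM mulrAC mulfK.
rewrite (funext countE); apply: cvgMr_tmp.
rewrite -[X in _ --> X](_ : \prod_(j < d.+1) tau = _); last first.
  by rewrite prodr_const card_ord.
apply: cvg_big => [|j _]; first exact: mul_continuous.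
apply: (@cvg_ratio (fun e => u e + j)%N tau (c + j%:R)) => e.
rewrite natrD addrAC; apply: le_trans (ler_normD _ _) _.
by rewrite lerD // ger0_norm.
Qed.

Lemma dist_subn (a b : nat) (x c : K) : `|a%:R - x| <= c ->
  `|(a - b)%:R - Num.max (x - b%:R) 0| <= c.
Proof.
rewrite !ler_distl => /andP[h1 h2].
have [ba|/ltnW ab] := leqP b a.
  have h3 : 0 <= (a - b)%:R :> K by [].
  rewrite natrB // in h3 *; case: (leP (x - b%:R) 0) => h4; apply/andP; split; lra.
have h3 : a%:R <= b%:R :> K by rewrite ler_nat.
have -> : (a - b)%:R = 0 :> K by move: ab; rewrite -subn_eq0 => /eqP ->.
by case: (leP (x - b%:R) 0) => h4; apply/andP; split; lra.
Qed.

(** Extending the sum to all [i <= d] by positive parts matches it, term by term,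
    with the inclusion-exclusion formula: a positive part is zero beyond
    [tau], a binomial coefficient beyond [d]. *)
Lemma HcalE d (tau : K) : (0 < d)%N -> Hcal d tau =
  \sum_(i < d.+1) (-1) ^+ i * 'C(d, i)%:R * (Num.max (tau - i%:R) 0 ^+ d / d`!%:R).
Proof.
move=> d0; rewrite /Hcal; case: ifPn => [tau0|]; last first.
  rewrite -leNgt => tau0; rewrite big1 // => i _.
  rewrite max_r ?expr0n ?gtn_eqF ?mul0r ?mulr0 //.
  by rewrite subr_le0 (le_trans tau0).
pose f i : K := (-1) ^+ i * 'C(d, i)%:R * (Num.max (tau - i%:R) 0 ^+ d / d`!%:R).
have sumE a b : (a <= b)%N -> (forall i, (a <= i)%N -> f i = 0) ->
    \sum_(0 <= i < a) f i = \sum_(0 <= i < b) f i.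
  move=> ab f0; rewrite [RHS](big_cat_nat (leq0n a) ab) //= [X in _ + X]big_nat_cond.
  by rewrite [X in _ + X]big1 ?addr0 // => i /andP[/andP[/f0]].
have [tl tu] := andP (truncn_itv (ltW tau0)).
set t := Num.truncn tau in tl tu *.
transitivity (\sum_(0 <= i < t.+1) f i).
  apply: eq_big_nat => i; rewrite ltnS => /andP[_ it].
  rewrite /f max_l; first by ring.
  by rewrite subr_ge0; apply: le_trans tl; rewrite ler_nat.
rewrite -(big_mkord xpredT f).
transitivity (\sum_(0 <= i < maxn t.+1 d.+1) f i).
  apply: sumE => [|i ti]; first exact: leq_maxl.
  rewrite /f max_r ?expr0n ?gtn_eqF ?mul0r ?mulr0 //.
  by rewrite subr_le0; apply: le_trans (ltW tu) _; rewrite ler_nat.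
apply/esym; apply: sumE => [|i di]; first exact: leq_maxr.
by rewrite /f bin_small // mulr0 mul0r.
Qed.

Lemma cvg_trunc_count d (u : nat -> nat) (tau c : K) : (0 < d)%N ->
  (forall e, `|(u e)%:R - tau * (q e)%:R| <= c) ->
  ((trunc_count d (u e) (q e))%:R / (q e)%:R ^+ d : K) @[e --> \oo] -->
  Hcal d tau.
Proof.
move=> d0 uc; rewrite HcalE //.
have countE e : (trunc_count d (u e) (q e))%:R / (q e)%:R ^+ d =
    \sum_(i < d.+1) (-1) ^+ i * 'C(d, i)%:R *
      ((monomial_count d (u e - i * q e))%:R / (q e)%:R ^+ d) :> K.
  by rewrite trunc_countE mulr_suml; apply: eq_bigr => i _; rewrite mulrA.
rewrite (funext countE).
apply: cvg_big => [|i _]; first exact: add_continuous.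
apply: cvgMl_tmp; apply: (@cvg_monomial_count _ _ _ c) => // e.
have -> : Num.max (tau - i%:R) 0 * (q e)%:R =
    Num.max (tau * (q e)%:R - (i * q e)%:R) 0 :> K.
  by rewrite maxr_pMl // mul0r mulrBl natrM.
exact: dist_subn.
Qed.

End Ratios.

(** [Hcal d tau] is a limit of normalized counts. *)
Lemma Hcal_ge0 d (tau : K) : (0 < d)%N -> 0 <= tau -> 0 <= Hcal d tau.
Proof.
move=> d0 tau0.
have c : forall e : nat, `|(Num.truncn (tau * e%:R))%:R - tau * e%:R| <= 1 :> K.
  move=> e; have := truncn_itv (mulr_ge0 tau0 (ler0n K e)).
  by rewrite ler_distl -natr1 => /andP[h1 h2]; apply/andP; split; lra.
have cv := cvg_trunc_count (@cvgr_idn K) d0 c.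
rewrite -(cvg_lim _ cv) //; apply: limr_ge; first by apply/cvg_ex; exists (Hcal d tau).
by near=> e; rewrite divr_ge0 // exprn_ge0.
Unshelve. all: by end_near. Qed.

End Asymptotics.

(** * Parameter ideals and multiplicities *)

Section ParameterIdeal.
Variables (R : comNzRingType) (m : set R) (d : nat) (J : set R).
Hypotheses (noeth : noetherian R) (locR : local_ring m).
Implicit Types (A I : set R) (s : seq R).

Lemma krull_dim_unique a b : krull_dim_is R a -> krull_dim_is R b -> a = b.
Proof.
move=> [ca lea] [cb leb]; apply/eqP; rewrite eqn_leq.
by rewrite leb // lea.
Qed.

(** The sequence is reversed to fit the recursion of [trunc_power], which splits
    off the last element of a regular sequence. *)
Lemma parameter_regseq : krull_dim_is R d -> cohen_macaulay m ->
  parameter_ideal m d J ->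
  exists s, [/\ size s = d, regseq [set 0] (rev s),
    adjoins [set 0] (rev s) = J & adjoins [set 0] s = J].
Proof.
move=> dimR [n [dimn [[z rz] _]]] [mJ [x JE]].
rewrite (krull_dim_unique dimn dimR) in z rz.
have i0 : ideal [set 0 : R] by exact: ideal_zero.
rewrite ideal_gen_range in JE; set xs := map _ _ in JE.
have [||||s' [s'd rs' s'E]] := @regular_parameters R m noeth locR d [set 0] xs i0.
- by rewrite size_map size_enum_ord.
- by move=> v vs; apply: (m_primary_sub mJ); rewrite JE; exact: mem_adjoins.
- exact: regular_sequence_depth rz.
- by move=> y my; rewrite -JE; exact: m_primary_expr mJ my.
exists (rev s'); rewrite size_rev revK s'E -JE; split=> //.
rewrite JE -s'E -!ideal_gen_seq; congr ideal_gen.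
by apply/seteqP; split=> v; rewrite /= mem_rev.
Qed.

Variable s : seq R.
Hypotheses (size_s : size s = d) (regs : regseq [set 0] (rev s)).
Hypotheses (genr : adjoins [set 0] (rev s) = J) (gen : adjoins [set 0] s = J).
Hypothesis mJ : m_primary m J.

Let gen_mem u : u \in s -> J u.
Proof. by move=> us; rewrite -gen; apply: mem_adjoins => //; exact: ideal_zero. Qed.

Lemma colen_trunc_power n q : finite_colen (trunc_power s n q) /\
  colen (trunc_power s n q) = (trunc_count d n q * colen J)%N.
Proof.
have fJ : finite_colen J.
  apply: (finite_colen_powers (k := 1%N) noeth locR mJ) => //.
  exact: m_primary_ideal mJ.
by have := filtered_trunc_power n q regs; rewrite genr size_s; exact: colen_filtered.
Qed.

Lemma colen_trunc_le A n q : ideal A -> ideal_exp J n `<=` A ->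
  (forall u, J u -> A (u ^+ q)) -> (colen A <= trunc_count d n q * colen J)%N.
Proof.
move=> iA JA qA; have [fT <-] := colen_trunc_power n q; apply: colenS fT.
by apply: trunc_power_sub => //; [rewrite gen|move=> u /gen_mem; exact: qA].
Qed.

Lemma colen_trunc_ge A n q : finite_colen A -> A `<=` trunc_power s n q ->
  (trunc_count d n q * colen J <= colen A)%N.
Proof. by move=> fA AT; have [_ <-] := colen_trunc_power n q; exact: colenS. Qed.

Section Reduction.
Variables (I : set R) (n0 : nat).
Hypotheses (mI : m_primary m I) (JI : J `<=` I).
Hypothesis redI : forall k, ideal_exp I (n0 + k) `<=` ideal_exp J k.

Lemma exp_sub_trunc_power n q : ideal_exp I n `<=` trunc_power s (n - n0) q.
Proof.
have [le|/ltnW] := leqP n0 n.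
  rewrite -{1}(subnKC le) => x /redI; rewrite -gen; exact: sub_trunc_power.
by rewrite -subn_eq0 => /eqP ->; rewrite trunc_power0.
Qed.

Lemma finite_colen_exp n : finite_colen (ideal_exp I n).
Proof.
apply: (finite_colen_powers (k := n) noeth locR mI); first exact: ideal_exp_ideal.
by move=> u; exact: ideal_exp_exp.
Qed.

Lemma colen_exp_bounds n :
  (trunc_count d (n - n0) (n - n0) * colen J <= colen (ideal_exp I n) <=
   trunc_count d n n * colen J)%N.
Proof.
apply/andP; split.
  by apply: colen_trunc_ge; [exact: finite_colen_exp|exact: exp_sub_trunc_power].
apply: colen_trunc_le; first exact: ideal_exp_ideal.
  exact: ideal_expS.
by move=> u /JI; exact: ideal_exp_exp.
Qed.

(** Both bounds on the colength of [I^n] are [colen J] times the number of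
    monomials of degree less than [n], up to a bounded shift of [n]. *)
Lemma hs_multE (K : realType) : (0 < d)%N -> hs_mult K d I = (colen J)%:R.
Proof.
move=> d0; apply: cvg_lim => //.
have lenE n : fine (length_quot K (ideal_exp I n)) = (colen (ideal_exp I n))%:R.
  exact: fine_length_quot (finite_colen_exp n).
have fact_neq0 : (d`!)%:R != 0 :> K by rewrite pnatr_eq0 -lt0n fact_gt0.
have cv (u : nat -> nat) (c : K) : (forall n, `|(u n)%:R - 1 * n%:R| <= c) ->
    ((d`!)%:R * (colen J)%:R * ((monomial_count d (u n))%:R / n%:R ^+ d) : K)
      @[n --> \oo] --> ((colen J)%:R : K).
  move=> uc; have := cvg_monomial_count (@cvgr_idn K) d0 uc.
  move=> /(@cvgMl_tmp K _ _ _ _ ((d`!)%:R * (colen J)%:R)).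
  by rewrite expr1n mul1r mulrAC mulfV // mul1r.
apply: (@squeeze_cvgr _ _ _ _
  (fun n => (d`!)%:R * (colen J)%:R * ((monomial_count d (n - n0))%:R / n%:R ^+ d))
  (fun n => (d`!)%:R * (colen J)%:R * ((monomial_count d n)%:R / n%:R ^+ d))).
- near=> n; rewrite lenE; have := colen_exp_bounds n.
  rewrite !trunc_count_diag => /andP[le1 le2].
  have E k : (d`!)%:R * (colen J)%:R * (k%:R / n%:R ^+ d) =
      (d`!)%:R * (k * colen J)%:R / n%:R ^+ d :> K by rewrite natrM; ring.
  by rewrite !E !ler_wpM2r ?invr_ge0 ?exprn_ge0 // ler_wpM2l // ler_nat.
- apply: (cv _ (n0%:R)) => n; rewrite mul1r distrC.
  have [le|/ltnW le] := leqP n0 n.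
    by rewrite natrB // opprB addrC subrK ger0_norm.
  have -> : (n - n0 = 0)%N by apply/eqP; rewrite subn_eq0.
  by rewrite subr0 ger0_norm // ler_nat.
- by apply: (cv id 0) => n; rewrite mul1r subrr normr0.
Unshelve. all: by end_near. Qed.

Variable p : nat.
Hypotheses (charR : p \in [pchar R]) (d_gt0 : (0 < d)%N) (dimR : krull_dim_is R d).

Lemma finite_colen_add_frobenius n e :
  finite_colen (ideal_add (ideal_exp I n) (frobenius_power p I e)).
Proof.
apply: (finite_colen_frobenius noeth locR (e := e) mI); first exact: add_frobenius_ideal.
exact: sub_add_frobenius.
Qed.

(** [I^n + J^[q]] is contained in [J^(n-n0) + J^[q]] and [I^(n-q) + J^[q]] contains
    [J^(n-q) + J^[q]], whose colengths are counted by monomials. *)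
Lemma colen_add_frobenius_ge : exists C e0, forall e n n', (e0 <= e)%N ->
  (p ^ e <= n)%N -> (n <= n')%N ->
  (trunc_count d (n - n0) (p ^ e) * colen J <=
   colen (ideal_add (ideal_exp I n') (frobenius_power p I e)) +
   mu_quot I (tight_closure p J) * (trunc_count d (n - p ^ e) (p ^ e) * colen J) +
   C * (p ^ e) ^ d.-1)%N.
Proof.
have iI := m_primary_ideal mI.
have [C [e0 bound]] := colen_frobenius_le noeth locR charR d_gt0 dimR mJ iI JI.
exists C, e0 => e n n' le qn nn'.
apply: leq_trans (_ : (_ <=
  colen (ideal_add (ideal_exp I n) (frobenius_power p J e)))%N) _.
  apply: colen_trunc_ge.
    apply: (finite_colen_frobenius noeth locR (e := e) mJ).
      exact: add_frobenius_ideal.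
    exact: sub_add_frobenius.
  have iT := trunc_power_ideal s (n - n0) (p ^ e).
  apply: ideal_add_sub => //; first exact: exp_sub_trunc_power.
  apply: frobenius_power_sub => // x.
  rewrite -gen; move: x; apply: adjoins_sub; first exact: (frobenius_ideal charR e iT).
    by move=> _ ->; exact: (ideal_0 (frobenius_ideal charR e iT)).
  by move=> v vs; exact: trunc_power_pow.
apply: leq_trans (bound e n le qn) _; rewrite leq_add2r; apply: leq_add.
  apply: colenS; last exact: finite_colen_add_frobenius.
  apply: ideal_add_sub; first exact: add_frobenius_ideal.
  - move=> x /(ideal_exp_leq nn'); apply: ideal_add_subl.
    exact: frobenius_power_ideal.
  - exact: sub_add_frobenius.
rewrite leq_mul2l; apply/orP; right; apply: colen_trunc_le.
- exact: add_frobenius_ideal.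
- move=> x /(ideal_expS JI); apply: ideal_add_subl; exact: frobenius_power_ideal.
- by move=> u Ju; apply: sub_add_frobenius; exact: frobenius_power_pow.
Qed.

End Reduction.
End ParameterIdeal.

Section CeilBounds.
Variable K : realType.
Implicit Types (x y : K).

Lemma ceil_natP x : 0 <= x -> x <= (`|Num.ceil x|%N)%:R < x + 1.
Proof.
move=> x0; have c0 : 0 <= Num.ceil x by rewrite ceil_ge0 (lt_le_trans _ x0) // ltrN10.
have -> : (`|Num.ceil x|%N)%:R = (Num.ceil x)%:~R :> K.
  by rewrite natr_absz ger0_norm.
by rewrite ceil_ge /= -ltrBlDr -(intrB _ _ 1) ceilB1_lt.
Qed.

Lemma ceil_nat_le x y : 0 <= x -> x <= y -> (`|Num.ceil x| <= `|Num.ceil y|)%N.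
Proof.
move=> x0 xy.
have /andP[_ h1] := ceil_natP x0; have /andP[h2 _] := ceil_natP (le_trans x0 xy).
rewrite -ltnS -(ltr_nat K) -natr1; apply: lt_le_trans h1 _; lra.
Qed.

End CeilBounds.

Theorem theorem3p8 (K : realType) (R : comNzRingType) (m : set R) (p d : nat)
    (R_noetherian : noetherian R)
    (R_local : local_ring m)
    (R_char : p \in [pchar R])
    (d_gt0 : (0 < d)%N)
    (R_dim : krull_dim_is R d)
    (R_CM : cohen_macaulay m)
    (I J : set R)
    (I_primary : m_primary m I)
    (J_reduction : reduction J I)
    (J_parameter : parameter_ideal m d J)
    (r s t : K)
    (r_ge : (mu_quot I (tight_closure p J))%:R <= r)
    (t_ge1 : 1 <= t)
    (t_le_s : t <= s)
    (* the limit defining h_s(I, I) exists *)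
    (h_exists : cvgn (h_seq p d s I I)) :
  s_mult p d s I >=
    (Hcal d t - r * Hcal d (t - 1)) / Hcal d s * hs_mult K d I.
Proof.
have [mJ _] := J_parameter; have [_ JI _] := J_reduction.
have [n0 redI] := reduction_exp J_reduction.
have [xs [size_xs reg_xs genr gen]] :=
  parameter_regseq R_noetherian R_local R_dim R_CM J_parameter.
have p1 : (1 < p)%N by rewrite prime_gt1 // (pcharf_prime R_char).
have q_infty : ((p ^ e)%N%:R : K) @[e --> \oo] --> +oo.
  apply: ger_cvgy (@cvgr_idn K); near=> e.
  by rewrite ler_nat ltnW // ltn_expl.
rewrite (hs_multE R_noetherian R_local size_xs reg_xs genr gen mJ I_primary JI redI) //.
set ell := (colen J)%:R; set mu := mu_quot I _ in r_ge.
have ell0 : 0 <= ell :> K by [].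
pose M x (e : nat) := `|Num.ceil (x * (p ^ e)%:R : K)|%N.
have q0 e : 0 <= (p ^ e)%:R :> K by [].
have M_bounds e : t * (p ^ e)%:R <= (M t e)%:R < t * (p ^ e)%:R + 1.
  by apply: ceil_natP; apply: mulr_ge0 => //; lra.
have qM e : (p ^ e <= M t e)%N.
  rewrite -(ler_nat K); have /andP[h _] := M_bounds e.
  by apply: le_trans h; rewrite ler_peMl.
have MM e : (M t e <= M s e)%N.
  by apply: ceil_nat_le; [apply: mulr_ge0 => //; lra|exact: ler_wpM2r].
have [C [e0 bound]] := colen_add_frobenius_ge R_noetherian R_local size_xs reg_xs
  genr gen mJ I_primary JI redI R_char d_gt0 R_dim.
have h_seqE e : h_seq p d s I I e =
    (colen (ideal_add (ideal_exp I (M s e)) (frobenius_power p I e)))%:R /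
    (p ^ e)%:R ^+ d.
  rewrite /h_seq fine_length_quot ?expnM; first by rewrite (natrX K (p ^ e) d).
  exact: (finite_colen_add_frobenius R_noetherian R_local I_primary).
have lim1 : ((trunc_count d (M t e - n0) (p ^ e))%:R / (p ^ e)%:R ^+ d : K)
    @[e --> \oo] --> Hcal d t.
  apply: (cvg_trunc_count q_infty (c := 1 + n0%:R)) => // e.
  have /andP[h1 h2] := M_bounds e; rewrite ler_distl.
  have [le|/ltnW le] := leqP n0 (M t e).
    by rewrite natrB //; have := ler0n K n0 => ?; apply/andP; split; lra.
  have -> : (M t e - n0 = 0)%N by apply/eqP; rewrite subn_eq0.
  have h3 : (M t e)%:R <= n0%:R :> K by rewrite ler_nat.
  have h4 : 0 <= t * (p ^ e)%:R by apply: mulr_ge0 => //; lra.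
  by apply/andP; split; lra.
have lim2 : ((trunc_count d (M t e - p ^ e) (p ^ e))%:R / (p ^ e)%:R ^+ d : K)
    @[e --> \oo] --> Hcal d (t - 1).
  apply: (cvg_trunc_count q_infty (c := 1)) => // e.
  have /andP[h1 h2] := M_bounds e; rewrite ler_distl natrB //.
  by rewrite mulrBl mul1r; apply/andP; split; lra.
have main : Hcal d t * ell <= h_mult p d s I I + mu%:R * (Hcal d (t - 1) * ell).
  have cvr : (h_seq p d s I I e + mu%:R *
      ((trunc_count d (M t e - p ^ e) (p ^ e))%:R / (p ^ e)%:R ^+ d * ell) +
      C%:R * (p ^ e)%:R^-1 : K) @[e --> \oo] -->
      h_mult p d s I I + mu%:R * (Hcal d (t - 1) * ell) + C%:R * 0.
    apply: cvgD; last by apply: cvgMl_tmp; exact: cvg_inv_q.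
    by apply: cvgD => //; apply: cvgMl_tmp; exact: cvgMr_tmp.
  rewrite mulr0 addr0 in cvr.
  apply: (ler_cvg_to (cvgMr_tmp lim1) cvr); near=> e.
  have qe : 0 < (p ^ e)%:R :> K by rewrite ltr0n expn_gt0 ltnW.
  have ee : (e0 <= e)%N by near: e; exact: nbhs_infty_ge.
  have := bound e (M t e) (M s e) ee (qM e) (MM e).
  rewrite -(ler_nat K) !natrD !natrM => h.
  have E : ((p ^ e) ^ d.-1)%N%:R / (p ^ e)%:R ^+ d = (p ^ e)%:R^-1 :> K.
    rewrite (natrX K (p ^ e) d.-1) -[in X in _ / X](prednK d_gt0) exprSr invfM mulrA.
    by rewrite mulfV ?mul1r // expf_neq0 // lt0r_neq0.
  have qd0 : 0 <= ((p ^ e)%:R ^+ d)^-1 :> K by rewrite invr_ge0 exprn_ge0.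
  rewrite h_seqE -E; have := ler_wpM2r qd0 h; congr (_ <= _); ring.
rewrite /s_mult /s_mult2 -mulrA [_^-1 * _]mulrC mulrA.
apply: ler_wpM2r.
  by rewrite invr_ge0; apply: Hcal_ge0 => //; lra.
have H0 : 0 <= Hcal d (t - 1) by apply: Hcal_ge0 => //; lra.
have h1 : mu%:R * (Hcal d (t - 1) * ell) <= r * (Hcal d (t - 1) * ell).
  by apply: ler_wpM2r => //; exact: mulr_ge0.
rewrite mulrBl -mulrA; lra.
Unshelve. all: by end_near. Qed.
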